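(* Let $A$ be a commutative Noetherian ring and let $\mathfrak{F}=(I_n)_{n\ge 0}$ be a good filtration of $A$. Then, for integers $i\ge 0$: (i) $a_i(R(\mathfrak{F}))\le a_i(G(\mathfrak{F}))$ for all $i\ne 1$; (ii) for all $i\neq 1$, if $a_i(G(\mathfrak{F}))\ge a_{i+1}(G(\mathfrak{F}))$ then $a_i(R(\mathfrak{F}))=a_i(G(\mathfrak{F}))$; (iii) if $H^1_{G(\mathfrak{F})_+}(G(\mathfrak{F}))\ne 0$ or $I_1\subseteq\sqrt{0}$, then (i) and (ii) also hold for $i=1$, that is, $a_1(R(\mathfrak{F}))\le a_1(G(\mathfrak{F}))$, and $a_1(R(\mathfrak{F}))=a_1(G(\mathfrak{F}))$ whenever $a_1(G(\mathfrak{F}))\ge a_2(G(\mathfrak{F}))$; (iv) if $H^1_{G(\mathfrak{F})_+}(G(\mathfrak{F}))=0$ and $I_1\not\subseteq\sqrt{0}$, then $a_1(R(\mathfrak{F}))=-1$.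
   Context: A filtration of $A$ is a sequence $\mathfrak{F}=(I_n)_{n\ge0}$ of ideals with $I_0=A\supset I_1\supseteq I_2\supseteq\cdots$, $I_1\ne A$ and $I_iI_j\subseteq I_{i+j}$ for all $i,j\ge 0$. It is a good filtration if there is an ideal $I$ of $A$ with $I I_i\subseteq I_{i+1}$ for all $i\ge 0$ and $I_{n+1}=I I_n$ for all $n\gg 0$. The Rees algebra is $R(\mathfrak{F})=\bigoplus_{n\ge 0} I_nt^n$ and the associated graded ring is $G(\mathfrak{F})=\bigoplus_{n\ge0} I_n/I_{n+1}$. For a nonnegatively graded ring $S$, $S_+$ is the ideal generated by the homogeneous elements of positive degree. For a graded $S$-module $M$ with homogeneous components $M_n$, $a(M)=\max\{n: M_n\ne 0\}$ if $M\neq 0$ and $a(M)=-\infty$ if $M=0$; $a_i(M)=a(H^i_{S_+}(M))$, where $H^i_{S_+}$ is the $i$-th (graded) local cohomology functor with respect to $S_+$. Thus $a_i(R(\mathfrak{F}))$ uses $R(\mathfrak{F})_+$ and $a_i(G(\mathfrak{F}))$ uses $G(\mathfrak{F})_+$. $\sqrt{0}$ is the nilradical of $A$. *)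

(* Defs.v *)
From HB Require Import structures.
From mathcomp Require Import all_boot all_order all_algebra.
From mathcomp Require Import all_classical constructive_ereal.
From mathcomp Require Import ring_quotient.

Set Implicit Arguments.
Unset Strict Implicit.
Unset Printing Implicit Defensive.

Import Order.TTheory GRing.Theory Num.Theory.

Local Open Scope classical_set_scope.
Local Open Scope ring_scope.

Section Ideals.
Variable A : comNzRingType.
Implicit Types (I J X : set A).

Definition is_ideal I : Prop :=
  I 0 /\ forall a u v, I u -> I v -> I (a * u + v).

Definition ideal_span X : set A :=
  [set x | exists (n : nat) (a g : 'I_n -> A),
     (forall i, X (g i)) /\ x = \sum_(i < n) a i * g i].

Definition ideal_mul I J : set A :=
  ideal_span [set x | exists u v, [/\ I u, J v & x = u * v]].

Definition ideal_pow I (k : nat) : set A := iter k (ideal_mul I) setT.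

Definition noetherian : Prop :=
  forall I, is_ideal I -> exists s : seq A, I = ideal_span [set` s].

Definition nilradical : set A := [set x | exists n : nat, x ^+ n = 0].

Record filtration := Filtration {
  fil :> nat -> set A;
  fil_ideal : forall n, is_ideal (fil n);
  fil_0 : fil 0%N = setT;
  fil_decr : forall n, fil n.+1 `<=` fil n;
  fil_1 : fil 1%N <> setT;
  fil_mul : forall i j, ideal_mul (fil i) (fil j) `<=` fil (i + j)%N }.

Definition good_filtration (F : filtration) : Prop :=
  exists I, [/\ is_ideal I,
    (forall i, ideal_mul I (F i) `<=` F i.+1) &
    exists n0, forall n, (n0 <= n)%N -> F n.+1 = ideal_mul I (F n)].

End Ideals.

Arguments nilradical A : clear implicits.

(* Internal direct sum decomposition of V into the subgroups P n. *)
Definition is_grading (T : eqType) (V : zmodType) (P : T -> set V) : Prop :=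
  [/\ (forall n, P n 0),
      (forall n x y, P n x -> P n y -> P n (x - y)),
      (forall v, exists (s : seq T) (f : T -> V),
         (forall n, P n (f n)) /\ v = \sum_(n <- s) f n) &
      (forall (s : seq T) (f : T -> V), uniq s -> (forall n, P n (f n)) ->
         \sum_(n <- s) f n = 0 -> forall n, n \in s -> f n = 0)].

Record gradedRing := GradedRing {
  gr_ring :> comNzRingType;
  gr_comp : nat -> set gr_ring;
  gr_grading : is_grading gr_comp;
  gr_one : gr_comp 0%N 1;
  gr_mul : forall m n x y,
    gr_comp m x -> gr_comp n y -> gr_comp (m + n)%N (x * y) }.

Definition irrelevant_ideal (S : gradedRing) : set S :=
  ideal_span [set s | exists2 n, (0 < n)%N & @gr_comp S n s].

Record gradedModule (S : gradedRing) := GradedModule {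
  gm_module :> lmodType S;
  gm_comp : int -> set gm_module;
  gm_grading : is_grading gm_comp;
  gm_scale : forall (m : nat) (n : int) (s : S) x,
    @gr_comp S m s -> gm_comp n x -> gm_comp (m%:Z + n) (s *: x) }.

Section Regular.
Variable S : gradedRing.

Definition regular_comp (n : int) : set S^o :=
  if n is Posz m then @gr_comp S m else [set 0].

Lemma regular_grading : is_grading regular_comp.
Proof.
have [S0 SB Sex Sun] := gr_grading S; split.
- by case=> [n|n]; [exact: S0 | rewrite /regular_comp].
- case=> [n|n] x y; first exact: SB.
  by rewrite /regular_comp /= => -> ->; rewrite subr0.
- move=> v; have [s [f [Pf ->]]] := Sex v.
  exists [seq Posz n | n <- s], (fun n => if n is Posz m then f m else 0).
  by split; [case=> // n; exact: Pf | rewrite big_map].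
- move=> s f us Pf sf0.
  pose t := [seq `|n|%N | n <- s & 0 <= n].
  have ut : uniq t.
    rewrite map_inj_in_uniq ?filter_uniq // => x y.
    rewrite !mem_filter => /andP[x0 _] /andP[y0 _].
    by case: x x0 => // x _; case: y y0 => // y _ /= ->.
  have st : \sum_(n <- t) f (Posz n) = 0.
    rewrite -[RHS]sf0 /t big_map big_filter [RHS](bigID (fun n : int => 0 <= n)) /=.
    rewrite [X in _ = _ + X]big1 ?addr0; last first.
      by case=> // n _; exact: (Pf (Negz n)).
    by apply: eq_bigr; case.
  case=> [n|n] ns; last exact: (Pf (Negz n)).
  apply: (Sun t (fun n => f (Posz n))) => //; first by move=> k; exact: (Pf (Posz k)).
  by apply/mapP; exists (Posz n) => //; rewrite mem_filter ns.
Qed.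

Lemma regular_scale (m : nat) (n : int) (s : S) (x : S^o) :
  @gr_comp S m s -> regular_comp n x -> regular_comp (m%:Z + n) (s *: x).
Proof.
case: n => [n|n] Ps Px; first exact: gr_mul.
have [P0 _ _ _] := regular_grading.
by move: Px; rewrite {1}/regular_comp /= => ->; rewrite scaler0; exact: P0.
Qed.

Definition regular : gradedModule S := GradedModule regular_grading regular_scale.

End Regular.

Section LocalCohomology.
Variable S : gradedRing.

Definition is_graded (M N : gradedModule S) (f : M -> N) : Prop :=
  forall n x, @gm_comp S M n x -> @gm_comp S N n (f x).

(* Injective object of the category of graded S-modules and homogeneous
   S-linear maps of degree 0. *)
Definition graded_injective (E : gradedModule S) : Prop :=
  forall (N N' : gradedModule S) (j : {linear N -> N'}) (f : {linear N -> E}),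
    injective j -> is_graded j -> is_graded f ->
    exists2 g : {linear N' -> E}, is_graded g & forall x, g (j x) = f x.

Record injective_resolution (M : gradedModule S) := InjectiveResolution {
  res :> nat -> gradedModule S;
  res_injective : forall i, graded_injective (res i);
  res_aug : {linear M -> res 0%N};
  res_d : forall i, {linear res i -> res i.+1};
  res_aug_graded : is_graded res_aug;
  res_d_graded : forall i, is_graded (res_d i);
  res_aug_inj : injective res_aug;
  res_exact0 : forall x, res_d 0%N x = 0 <-> exists y, x = res_aug y;
  res_exact : forall i x, res_d i.+1 x = 0 <-> exists y, x = res_d i y }.

Definition torsion (I : set S) (M : gradedModule S) : set M :=
  [set x | exists k, forall s, ideal_pow I k s -> s *: x = 0].

(* The graded local cohomology of M at S_+ is the right derived functor of
   torsion (irrelevant_ideal S): H^i is the graded subquotient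
   lc_cycles i / lc_boundaries i of the i-th term of an injective resolution;
   it is only used through the nonvanishing of its components, so the quotient
   module itself is not formed. *)
Section Derived.
Variables (M : gradedModule S) (E : injective_resolution M).

Definition lc_cycles (i : nat) : set (E i) :=
  [set z | torsion (@irrelevant_ideal S) z /\ res_d E i z = 0].

Definition lc_boundaries (i : nat) : set (E i) :=
  match i with
  | 0%N => [set 0]
  | j.+1 => [set z | exists2 y : E j,
                       torsion (@irrelevant_ideal S) y & z = res_d E j y]
  end.

Definition lc_neq0 (i : nat) : Prop :=
  exists2 z, lc_cycles z & ~ @lc_boundaries i z.

Definition lc_comp_neq0 (i : nat) (n : int) : Prop :=
  exists z, [/\ @gm_comp S (E i) n z, lc_cycles z & ~ @lc_boundaries i z].

End Derived.
End LocalCohomology.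

Definition is_max (P : set int) (m : int) : Prop :=
  P m /\ forall n, P n -> n <= m.

(* The value +oo stands for a nonempty P without a maximum. *)
Definition max_degree (P : set int) : \bar int :=
  match pselect (exists m, is_max P m) with
  | left h => (projT1 (cid h))%:E
  | right _ => if `[< P = set0 >] then -oo%E else +oo%E
  end.

Definition a_inv (S : gradedRing) (M : gradedModule S)
    (E : injective_resolution M) (i : nat) : \bar int :=
  max_degree (lc_comp_neq0 E i).

Section Rees.
Variables (A : comNzRingType) (F : filtration A).

Definition rees_pred : {pred {poly A}} :=
  fun p => `[< forall n, F n p`_n >].

Lemma fil_sum n (T : Type) (r : seq T) (P : pred T) (f : T -> A) :
  (forall i, P i -> F n (f i)) -> F n (\sum_(i <- r | P i) f i).
Proof.
have [I0 IM] := fil_ideal F n => Pf.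
elim/big_rec: _ => // i x Pi Fx; rewrite -[f i]mul1r; exact: IM (Pf i Pi) Fx.
Qed.

Lemma fil_mulr n a x : F n x -> F n (a * x).
Proof. by have [I0 IM] := fil_ideal F n => Fx; rewrite -[_ * _]addr0; exact: IM. Qed.

Lemma fil_sub n x y : F n x -> F n y -> F n (x - y).
Proof.
by have [I0 IM] := fil_ideal F n => Fx Fy; rewrite addrC -mulN1r; exact: IM.
Qed.

Lemma fil_prod i j x y : F i x -> F j y -> F (i + j)%N (x * y).
Proof.
move=> Fx Fy; apply: fil_mul; exists 1%N, (fun=> 1), (fun=> x * y); split.
  by move=> _; exists x, y.
by rewrite big_ord1 mul1r.
Qed.

Lemma rees_subring : subring_closed rees_pred.
Proof.
split.
- apply/asboolP => -[|n]; first by rewrite fil_0.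
  by rewrite coef1; have [] := fil_ideal F n.+1.
- move=> p q /asboolP Fp /asboolP Fq; apply/asboolP => n.
  by rewrite coefB; exact: fil_sub.
- move=> p q /asboolP Fp /asboolP Fq; apply/asboolP => n.
  rewrite coefM; apply: fil_sum => i _.
  suff: F (i + (n - i))%N (p`_i * q`_(n - i)) by rewrite subnKC // -ltnS.
  exact: fil_prod.
Qed.

HB.instance Definition _ :=
  GRing.isSubringClosed.Build {poly A} rees_pred rees_subring.

(* R(F), realized as the subring of A[t] of the p with p`_n in F n. *)
Record rees := Rees { rees_val :> {poly A}; _ : rees_val \in rees_pred }.

HB.instance Definition _ := [isSub for rees_val].
HB.instance Definition _ := [Choice of rees by <:].
HB.instance Definition _ := [SubChoice_isSubComNzRing of rees by <:].

Lemma reesP (p : rees) n : F n (rees_val p)`_n.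
Proof. by case: p => p /= /asboolP. Qed.

Definition rees_comp (n : nat) : set rees :=
  [set p | exists2 a, F n a & rees_val p = a *: 'X^n].

Lemma rees_mono_subproof n a : F n a -> a *: 'X^n \in rees_pred.
Proof.
move=> Fa; apply/asboolP => k; rewrite coefZ coefXn.
have [->|_] := eqVneq k n; first by rewrite mulr1.
by rewrite mulr0; have [] := fil_ideal F k.
Qed.

Definition rees_mono (p : rees) (n : nat) : rees :=
  Rees (rees_mono_subproof (reesP p n)).

Lemma rees_monoP p n : rees_comp n (rees_mono p n).
Proof. by exists (rees_val p)`_n => //; exact: reesP. Qed.

Lemma rees_val_sum (T : Type) (r : seq T) (f : T -> rees) :
  rees_val (\sum_(i <- r) f i) = \sum_(i <- r) rees_val (f i).
Proof. exact: (big_morph rees_val (id1 := 0) (op1 := +%R)). Qed.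

Lemma rees_mono_sum p : p = \sum_(n <- iota 0 (size (rees_val p))) rees_mono p n.
Proof.
apply: val_inj; rewrite [RHS]rees_val_sum /= -{1}[rees_val p]coefK poly_def.
by rewrite -(big_mkord xpredT (fun i => (rees_val p)`_i *: 'X^i)) /index_iota subn0.
Qed.

Lemma rees_comp0 n : rees_comp n 0.
Proof. by exists 0; [have [] := fil_ideal F n | rewrite scale0r]. Qed.

Lemma rees_compB n p q : rees_comp n p -> rees_comp n q -> rees_comp n (p - q).
Proof.
move=> [a Fa pE] [b Fb qE]; exists (a - b); first exact: fil_sub.
by rewrite scalerBl -pE -qE.
Qed.

Lemma coef_rees_sum (s : seq nat) (f : nat -> rees) n :
  uniq s -> (forall n, rees_comp n (f n)) -> n \in s ->
  (rees_val (\sum_(k <- s) f k))`_n = (rees_val (f n))`_n.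
Proof.
move=> us Pf ns; rewrite rees_val_sum coef_sum (bigD1_seq n) //=.
rewrite big1 ?addr0 // => k kn; have [a _ ->] := Pf k.
by rewrite coefZ coefXn eq_sym (negbTE kn) mulr0.
Qed.

Lemma rees_grading : is_grading rees_comp.
Proof.
split; [exact: rees_comp0 | exact: rees_compB | |].
- move=> p; exists (iota 0 (size (rees_val p))), (rees_mono p).
  by split; [exact: rees_monoP | exact: rees_mono_sum].
- move=> s f us Pf sf0 n ns; apply: val_inj => /=.
  have := coef_rees_sum us Pf ns; rewrite sf0 coef0.
  have [a _ ->] := Pf n.
  by rewrite coefZ coefXn eqxx mulr1 => <-; rewrite scale0r.
Qed.

Lemma rees_comp1 : rees_comp 0%N 1.
Proof. by exists 1; [rewrite fil_0 | rewrite expr0 scale1r]. Qed.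

Lemma rees_compM m n p q :
  rees_comp m p -> rees_comp n q -> rees_comp (m + n)%N (p * q).
Proof.
move=> [a Fa pE] [b Fb qE]; exists (a * b); first exact: fil_prod.
by rewrite /= pE qE -scalerAl -scalerAr scalerA exprD.
Qed.

Definition rees_algebra : gradedRing :=
  GradedRing rees_grading rees_comp1 rees_compM.

(* The homogeneous ideal whose degree n component is F n.+1 t^n. *)
Definition assoc_ideal : {pred rees} :=
  fun p => `[< forall n, F n.+1 (rees_val p)`_n >].

Lemma assoc_idealr : idealr_closed assoc_ideal.
Proof.
split.
- by apply/asboolP => n; rewrite coef0; have [] := fil_ideal F n.+1.
- apply/asboolP => /(_ 0%N); rewrite coef1 /= => F1.
  apply: (@fil_1 _ F); apply/seteqP; split => // x _.
  by rewrite -[x]mulr1; exact: fil_mulr.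
- move=> a u v /asboolP Fu /asboolP Fv; apply/asboolP => n /=.
  rewrite coefD -[X in _ + X]opprK; apply: fil_sub; last first.
    by rewrite -[- _]sub0r; apply: fil_sub => //; have [] := fil_ideal F n.+1.
  rewrite coefM; apply: fil_sum => i _.
  suff: F (i + (n - i).+1)%N ((rees_val a)`_i * (rees_val u)`_(n - i)).
    by rewrite addnS subnKC // -ltnS.
  exact: fil_prod (reesP a i) (Fu _).
Qed.

HB.instance Definition _ := isIdealr.Build rees assoc_ideal assoc_idealr.

(* G(F), realized as the quotient of R(F) by assoc_ideal: the degree n component
   of the quotient is F n t^n / F n.+1 t^n. *)
Definition assoc_ring : comNzRingType := {ideal_quot assoc_ideal}.

Local Open Scope quotient_scope.

Definition assoc_pi (p : rees) : assoc_ring := \pi_({ideal_quot assoc_ideal}) p.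

Definition assoc_comp (n : nat) : set assoc_ring :=
  [set assoc_pi p | p in rees_comp n].

Lemma assoc_piB p q : assoc_pi (p - q) = assoc_pi p - assoc_pi q.
Proof. by rewrite /assoc_pi rmorphB. Qed.

Lemma assoc_pi_sum (T : Type) (r : seq T) (f : T -> rees) :
  assoc_pi (\sum_(i <- r) f i) = \sum_(i <- r) assoc_pi (f i).
Proof. by rewrite /assoc_pi rmorph_sum. Qed.

Lemma assoc_piM p q : assoc_pi (p * q) = assoc_pi p * assoc_pi q.
Proof. by rewrite /assoc_pi rmorphM. Qed.

Lemma assoc_pi_eq0 p : assoc_pi p = 0 <-> forall n, F n.+1 (rees_val p)`_n.
Proof.
have -> : (assoc_pi p = 0) <-> (p \in assoc_ideal).
  rewrite -[p in p \in _]subr0 Quotient.idealrBE.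
  by rewrite /assoc_pi -[0]pi_zeror; split => [->|/eqP].
by split => [/asboolP|?]; [|apply/asboolP].
Qed.

Lemma assoc_grading : is_grading assoc_comp.
Proof.
split.
- by move=> n; exists 0; [exact: rees_comp0 | rewrite /assoc_pi rmorph0].
- move=> n _ _ [p Pp <-] [q Pq <-]; exists (p - q); first exact: rees_compB.
  exact: assoc_piB.
- move=> v; rewrite -[v]reprK -/(assoc_pi _); set p := repr v.
  exists (iota 0 (size (rees_val p))), (fun n => assoc_pi (rees_mono p n)).
  split; first by move=> n; exists (rees_mono p n) => //; exact: rees_monoP.
  by rewrite -assoc_pi_sum -rees_mono_sum.
- move=> s f us Pf sf0 n ns.
  have /choice[g Pg] : forall n, exists p, rees_comp n p /\ assoc_pi p = f n.
    by move=> k; have [p] := Pf k; exists p.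
  move: sf0; under eq_bigr do rewrite -(Pg _).2.
  rewrite -assoc_pi_sum => /assoc_pi_eq0/(_ n).
  rewrite coef_rees_sum // => [Fg|k]; last exact: (Pg k).1.
  rewrite -(Pg n).2; apply/assoc_pi_eq0 => k.
  move: Fg; have [a _ ->] := (Pg n).1; rewrite !coefZ !coefXn eqxx mulr1.
  have [->|_ _] := eqVneq k n; first by rewrite mulr1.
  by rewrite mulr0; have [] := fil_ideal F k.+1.
Qed.

Lemma assoc_comp1 : assoc_comp 0%N 1.
Proof. by exists 1; [exact: rees_comp1 | rewrite /assoc_pi rmorph1]. Qed.

Lemma assoc_compM m n x y :
  assoc_comp m x -> assoc_comp n y -> assoc_comp (m + n)%N (x * y).
Proof.
move=> [p Pp <-] [q Pq <-]; exists (p * q); first exact: rees_compM.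
exact: assoc_piM.
Qed.

Definition assoc_graded_ring : gradedRing :=
  GradedRing assoc_grading assoc_comp1 assoc_compM.

End Rees.

(* Main.v *)
Require Import Defs.
From HB Require Import structures.
From mathcomp Require Import all_boot all_order all_algebra.
From mathcomp Require Import all_classical constructive_ereal.
From mathcomp Require Import zify ring.

(** Write [R] and [G] for the Rees algebra and the associated graded ring, [x_j]
    for [a_j t], where [a_1, ..., a_r] generate the ideal [I] of the good
    filtration, and [H^i] for local cohomology at the irrelevant ideal. Two exact
    sequences drive the proof,

      0 -> R_+ -> R -> A -> 0     and     0 -> R_+(1) -> R -> G -> 0,

    where [A] sits in degree zero and is torsion. By the first, [H^i(R_+)] and
    [H^i(R)] agree except in degree zero for [i] at most [1]. By the second, in a
    degree [n] where [H^i(G)] vanishes, [H^i(R_+)_(n+1) -> H^i(R)_n] is onto; since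
    [H^i(R)] vanishes in large degrees, it vanishes in every degree above
    [a_i(G)], which is (i). If [m = a_i(G)] is at least [a_(i+1)(G)], then
    [H^(i+1)(R_+)_(m+1) = 0], so [H^i(R)_m] maps onto [H^i(G)_m]; this is (ii). For
    [i = 1] the argument breaks only between degrees [0] and [-1], where
    [H^1(R_+)_0] is the cokernel of [H^0(R)_0 -> A], nonzero unless [I_1] is
    nilpotent ([vP1_nil]); moreover [H^1(G)], if nonzero, is nonzero in some degree
    at least [-1] ([vG1_pred]). This gives (iii) and (iv).

    Local cohomology is defined by injective resolutions over two different rings.
    Both are compared with the direct limit of the Koszul cohomology of the powers
    [x_j ^ k], which depends only on the action of the [x_j] and has a long exact
    sequence for every exact sequence of graded families ([van_mid], [van_quot],
    [van_sub]). The comparison ([lc_comp_van]) is dimension shifting, and needs that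
    this limit vanishes in positive cohomological degrees for a graded injective [E]
    ([injective_van]). A cochain with values in [E] is a linear map from the
    Koszul complex of the ring to [E], so this follows from injectivity once the
    dual transition maps annihilate the cohomology of the Koszul complexes of the
    ring below the top degree [r].

    Everything therefore rests on one finiteness statement: in internal degrees
    above a bound independent of [k], the Koszul complexes of [R] and [G] are exact
    ([RC_acyclic], [GC_acyclic]). It gives at once the vanishing of [H^i(R)] in
    large degrees and, as dual transition maps raise internal degrees, the
    acyclicity of injectives. For [k = 1] it holds because cocycles form a finitely
    generated graded module, by Hilbert's basis theorem ([gideal_eventually]), whose
    elements of large degree are therefore sums of multiples of the [x_j], and the
    [x_j] are null-homotopic ([koszul_exact_above]). The cone of [x] is exact above
    a degree when [x] is bijective on cohomology there, and then so are its powers;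
    this passes from [1] to any [k] without changing the bound
    ([exact_koszul_pow]). *)

Set Implicit Arguments.
Unset Strict Implicit.
Unset Printing Implicit Defensive.

Import Order.TTheory GRing.Theory Num.Theory.

Local Open Scope classical_set_scope.
Local Open Scope ring_scope.

(** * Complexes with commuting operators, and Koszul complexes *)

Section Iterate.
Variables (B : nzRingType) (V : lmodType B) (f : {linear V -> V}).

Definition iter_lin (e : nat) (v : V) : V := iter e f v.

Lemma iter_lin_linear e : linear (iter_lin e).
Proof. by elim: e => [|e IH] a u v //=; rewrite IH linearP. Qed.

HB.instance Definition _ e :=
  GRing.isLinear.Build B V V *:%R (iter_lin e) (iter_lin_linear e).

Lemma iter_lin_comm (g : V -> V) e v :
  (forall u, f (g u) = g (f u)) -> iter_lin e (g v) = g (iter_lin e v).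
Proof. by move=> fg; elim: e => //= e ->. Qed.

End Iterate.

(** A complex with commuting operators and two gradings: [pr p] projects onto
    cohomological degree [p], and [deg n] is the set of elements of internal
    degree [n]. All terms of the complex are summed in one module, so that the
    carrier of an iterated cone is computed by the recursion that builds it. *)
Record opcx (B : nzRingType) := Opcx {
  car :> lmodType B;
  dif : {linear car -> car};
  op : nat -> {linear car -> car};
  pr : int -> {linear car -> car};
  deg : int -> set car;
  dif_dif : forall v, dif (dif v) = 0;
  dif_op : forall j v, dif (op j v) = op j (dif v);
  op_op : forall i j v, op i (op j v) = op j (op i v);
  pr_pr : forall p v, pr p (pr p v) = pr p v;
  dif_pr : forall p v, dif (pr p v) = pr (p + 1) (dif v);
  op_pr : forall j p v, op j (pr p v) = pr p (op j v);
  deg_0 : forall n, deg n 0;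
  deg_B : forall n u v, deg n u -> deg n v -> deg n (u - v);
  deg_dif : forall n v, deg n v -> deg n (dif v);
  deg_op : forall j n v, deg n v -> deg (n + 1) (op j v);
  deg_pr : forall p n v, deg n v -> deg n (pr p v) }.

Arguments pr {B} o p.
Arguments deg {B} o n.
Arguments op {B} o j.
Arguments dif {B} o.

Section Opcx.
Variables (B : nzRingType) (C : opcx B).

Definition bideg (p n : int) : set C := [set v | deg C n v /\ pr C p v = v].

Lemma deg_N n v : deg C n v -> deg C n (- v).
Proof. by move=> dv; rewrite -sub0r; apply: deg_B => //; exact: deg_0. Qed.

Lemma bideg_0 (p n : int) : bideg p n 0.
Proof. by split; [exact: deg_0 | rewrite linear0]. Qed.

Lemma bideg_B p n u v : bideg p n u -> bideg p n v -> bideg p n (u - v).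
Proof.
by move=> [du pu] [dv pv]; split; [exact: deg_B | rewrite linearB /= pu pv].
Qed.

Lemma bideg_N p n v : bideg p n v -> bideg p n (- v).
Proof. by move=> dv; rewrite -sub0r; apply: bideg_B => //; exact: bideg_0. Qed.

Lemma bideg_D p n u v : bideg p n u -> bideg p n v -> bideg p n (u + v).
Proof. by move=> du dv; rewrite -[v]opprK; apply: bideg_B => //; exact: bideg_N. Qed.

Lemma bideg_dif p n v : bideg p n v -> bideg (p + 1) n (dif C v).
Proof. by move=> [dv pv]; split; [exact: deg_dif | rewrite -dif_pr pv]. Qed.

Lemma bideg_op j p n v : bideg p n v -> bideg p (n + 1) (op C j v).
Proof. by move=> [dv pv]; split; [exact: deg_op | rewrite -op_pr pv]. Qed.

Definition opx (j e : nat) (v : C) : C := iter_lin (op C j) e v.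

Lemma opx_linear j e : linear (opx j e).
Proof. exact: linearP. Qed.

HB.instance Definition _ j e := GRing.isLinear.Build B C C *:%R (opx j e) (opx_linear j e).

Lemma opxE j e v : opx j e v = iter e (op C j) v. Proof. by []. Qed.

Lemma opx_op j e i v : opx j e (op C i v) = op C i (opx j e v).
Proof. by apply: iter_lin_comm => u; rewrite op_op. Qed.

Lemma opx_dif j e v : opx j e (dif C v) = dif C (opx j e v).
Proof. by apply: iter_lin_comm => u; rewrite dif_op. Qed.

Lemma opx_pr j e p v : opx j e (pr C p v) = pr C p (opx j e v).
Proof. by apply: iter_lin_comm => u; rewrite op_pr. Qed.

Lemma deg_opx j e n v : deg C n v -> deg C (n + e%:Z) (opx j e v).
Proof.
rewrite opxE => dv; elim: e => [|e IH] /=; first by rewrite addr0.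
have -> : n + e.+1%:Z = n + e%:Z + 1 by lia.
exact: deg_op.
Qed.

Lemma bideg_opx j e p n v : bideg p n v -> bideg p (n + e%:Z) (opx j e v).
Proof. by move=> [dv pv]; split; [exact: deg_opx | rewrite -opx_pr pv]. Qed.

End Opcx.

Arguments bideg {B} C p n.
Arguments opx {B} C j e v : simpl never.

Section Cone.
Variables (B : nzRingType) (j e : nat) (C : opcx B).

Definition cone_car : lmodType B := (C * C)%type.

Definition cone_dif (c : cone_car) : cone_car :=
  (dif C c.1, opx C j e c.1 - dif C c.2).

Lemma cone_dif_linear : linear cone_dif.
Proof.
move=> a [u1 u2] [v1 v2]; rewrite /cone_dif /=; congr pair; rewrite !linearP //=.
by rewrite scalerDr addrACA.
Qed.

HB.instance Definition _ :=
  GRing.isLinear.Build B cone_car cone_car *:%R cone_dif cone_dif_linear.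

Definition cone_op (i : nat) (c : cone_car) : cone_car := (op C i c.1, op C i c.2).

Lemma cone_op_linear i : linear (cone_op i).
Proof. by move=> a [u1 u2] [v1 v2]; rewrite /cone_op /= !linearP. Qed.

HB.instance Definition _ i :=
  GRing.isLinear.Build B cone_car cone_car *:%R (cone_op i) (cone_op_linear i).

Definition cone_pr (p : int) (c : cone_car) : cone_car :=
  (pr C p c.1, pr C (p - 1) c.2).

Lemma cone_pr_linear i : linear (cone_pr i).
Proof. by move=> a [u1 u2] [v1 v2]; rewrite /cone_pr /= !linearP. Qed.

HB.instance Definition _ p :=
  GRing.isLinear.Build B cone_car cone_car *:%R (cone_pr p) (cone_pr_linear p).

Definition cone_deg (n : int) : set cone_car :=
  [set c | deg C n c.1 /\ deg C (n + e%:Z) c.2].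

(** The cone of the [e]-th power of the [j]-th operator; the second summand is
    placed one cohomological degree higher. *)
Definition cone : opcx B.
Proof.
refine (@Opcx B cone_car cone_dif cone_op cone_pr cone_deg _ _ _ _ _ _ _ _ _ _ _).
- by move=> [u v]; rewrite /= /cone_dif /= !dif_dif linearB /= dif_dif subr0 opx_dif subrr.
- by move=> i [u v]; rewrite /= /cone_dif /cone_op /= !dif_op opx_op linearB.
- by move=> i i' [u v]; rewrite /= /cone_op /= op_op [op C i (op C i' v)]op_op.
- by move=> p [u v]; rewrite /= /cone_pr /= !pr_pr.
- move=> p [u v]; rewrite /= /cone_pr /cone_dif /= !dif_pr opx_pr.
  by rewrite (_ : p - 1 + 1 = p) 1?(_ : p + 1 - 1 = p) ?linearB //; lia.
- by move=> i p [u v]; rewrite /= /cone_pr /cone_op /= !op_pr.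
- by move=> n; split; exact: deg_0.
- by move=> n [u1 u2] [v1 v2] [? ?] [? ?]; split; exact: deg_B.
- move=> n [u v] [du dv]; split; first exact: deg_dif.
  by apply: deg_B; [exact: deg_opx | exact: deg_dif].
- move=> i n [u v] [du dv]; split; first exact: deg_op.
  by rewrite addrAC; exact: deg_op.
- by move=> p n [u v] [du dv]; split; exact: deg_pr.
Defined.

Lemma cone_bideg p n a b :
  bideg cone p n (a, b) <-> bideg C p n a /\ bideg C (p - 1) (n + e%:Z) b.
Proof.
split=> [[[/= da db] [pa pb]]|[[da pa] [db pb]]]; first by split; split.
by split=> //=; rewrite /cone_pr /= pa pb.
Qed.

End Cone.

(** The Koszul complex of the [k]-th powers of the first [r] operators, with
    coefficients in the complex [C], as an iterated cone. *)
Fixpoint koszul (B : nzRingType) (r k : nat) (C : opcx B) : opcx B :=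
  if r is r'.+1 then cone r' k (koszul r' k C) else C.

(** * Morphisms, short exact sequences and the long exact sequence *)

(** Morphisms only need to be additive, and may relate complexes over different
    rings; [a] is their internal degree. *)
Record morph (B B' : nzRingType) (a : int) (C : opcx B) (C' : opcx B')
    (f : C -> C') : Prop := Morph {
  morphB : forall u v, f (u - v) = f u - f v;
  morph_dif : forall v, f (dif C v) = dif C' (f v);
  morph_op : forall j v, f (op C j v) = op C' j (f v);
  morph_pr : forall p v, f (pr C p v) = pr C' p (f v);
  morph_deg : forall n v, deg C n v -> deg C' (n + a) (f v) }.

Section Morph.
Variables (B B' : nzRingType) (a : int) (C : opcx B) (C' : opcx B') (f : C -> C').
Hypothesis fM : morph a f.

Lemma morph0 : f 0 = 0.
Proof. by rewrite -(subrr 0) (morphB fM) subrr. Qed.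

Lemma morphN v : f (- v) = - f v.
Proof. by rewrite -sub0r (morphB fM) morph0 sub0r. Qed.

Lemma morphD u v : f (u + v) = f u + f v.
Proof. by rewrite -{1}[v]opprK (morphB fM) morphN opprK. Qed.

Lemma morph_bideg p n v : bideg C p n v -> bideg C' p (n + a) (f v).
Proof.
by move=> [dv pv]; split; [exact: (morph_deg fM) | rewrite -(morph_pr fM) pv].
Qed.

Lemma morph_opx j e v : f (opx C j e v) = opx C' j e (f v).
Proof. by rewrite !opxE; elim: e => //= e <-; rewrite (morph_op fM). Qed.

End Morph.

Definition cone_map (B B' : nzRingType) j e (C : opcx B) (C' : opcx B')
  (f : C -> C') (c : cone j e C) : cone j e C' := (f c.1, f c.2).

Lemma cone_morph (B B' : nzRingType) a j e (C : opcx B) (C' : opcx B')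
  (f : C -> C') : morph a f -> morph a (@cone_map _ _ j e _ _ f).
Proof.
move=> fM; split.
- by move=> [? ?] [? ?]; rewrite /cone_map /= !(morphB fM).
- move=> [? ?]; rewrite /cone_map /= /cone_dif /= (morphB fM) !(morph_dif fM).
  by rewrite (morph_opx fM).
- by move=> i [? ?]; rewrite /cone_map /= /cone_op /= !(morph_op fM).
- by move=> p [? ?]; rewrite /cone_map /= /cone_pr /= !(morph_pr fM).
- move=> n [u v] [/= du dv]; split; first exact: (morph_deg fM).
  by rewrite addrAC; exact: (morph_deg fM).
Qed.

Fixpoint kmap (B B' : nzRingType) (r k : nat) (C : opcx B) (C' : opcx B')
    (f : C -> C') : koszul r k C -> koszul r k C' :=
  if r is r'.+1 return koszul r k C -> koszul r k C'
  then cone_map (@kmap B B' r' k C C' f) else f.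

Lemma kmap_morph (B B' : nzRingType) a r k (C : opcx B) (C' : opcx B')
  (f : C -> C') : morph a f -> morph a (@kmap _ _ r k _ _ f).
Proof. by move=> fM; elim: r => //= r IH; exact: cone_morph. Qed.

(** Exactness of [0 -> Q -> C -> C' -> 0] in each internal degree; the inclusion
    [i] may shift that degree. *)
Record ses (B B' B'' : nzRingType) (a : int) (Q : opcx B) (C : opcx B')
    (C' : opcx B'') (i : Q -> C) (h : C -> C') : Prop := Ses {
  ses_i : morph a i;
  ses_h : morph 0 h;
  ses_surj : forall n c', deg C' n c' -> exists2 c, deg C n c & h c = c';
  ses_exact : forall n c, deg C (n + a) c -> h c = 0 ->
    exists2 q, deg Q n q & i q = c;
  ses_inj : forall n q, deg Q n q -> i q = 0 -> q = 0;
  ses_zero : forall n q, deg Q n q -> h (i q) = 0 }.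

Section Ses.
Variables (B B' B'' : nzRingType) (a : int) (Q : opcx B) (C : opcx B')
    (C' : opcx B'') (i : Q -> C) (h : C -> C').
Hypothesis ih : ses a i h.

Lemma ses_surj_bideg p n c' : bideg C' p n c' -> exists2 c, bideg C p n c & h c = c'.
Proof.
move=> [dc' pc']; have [c dc hc] := ses_surj ih dc'.
exists (pr C p c); first by split; [exact: deg_pr | rewrite pr_pr].
by rewrite (morph_pr (ses_h ih)) hc.
Qed.

Lemma ses_exact_bideg p n c : bideg C p (n + a) c -> h c = 0 ->
  exists2 q, bideg Q p n q & i q = c.
Proof.
move=> [dc pc] hc; have [q dq qc] := ses_exact ih dc hc.
exists (pr Q p q); first by split; [exact: deg_pr | rewrite pr_pr].
by rewrite (morph_pr (ses_i ih)) qc.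
Qed.

Lemma cone_ses j e : ses a (@cone_map _ _ j e _ _ i) (@cone_map _ _ j e _ _ h).
Proof.
split; [exact: cone_morph (ses_i ih) | exact: cone_morph (ses_h ih) | | | |].
- move=> n [c1 c2] [/= /(ses_surj ih) [u du hu] /(ses_surj ih) [v dv hv]].
  by exists (u, v); rewrite // /cone_map /= hu hv.
- move=> n [c1 c2] [/= d1 d2] [h1 h2]; rewrite addrAC in d2.
  have [u du hu] := ses_exact ih d1 h1; have [v dv hv] := ses_exact ih d2 h2.
  by exists (u, v); rewrite // /cone_map /= hu hv.
- move=> n [c1 c2] [/= d1 d2] [h1 h2].
  by rewrite (ses_inj ih d1 h1) (ses_inj ih d2 h2).
- move=> n [c1 c2] [/= d1 d2].
  by rewrite /cone_map /= (ses_zero ih d1) (ses_zero ih d2).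
Qed.

End Ses.

Lemma kmap_ses (B B' B'' : nzRingType) a r k (Q : opcx B) (C : opcx B')
  (C' : opcx B'') (i : Q -> C) (h : C -> C') :
  ses a i h -> ses a (@kmap _ _ r k _ _ i) (@kmap _ _ r k _ _ h).
Proof. by move=> ih; elim: r => //= r IH; exact: cone_ses. Qed.

(** The transition maps of the direct system whose limit is Čech cohomology: the
    component indexed by a set of operators is the numerator of a fraction whose
    denominator is the product of the [k]-th powers of these operators. *)
Fixpoint tau (B : nzRingType) (r k k' : nat) (C : opcx B) :
    koszul r k C -> koszul r k' C :=
  if r is r'.+1 return koszul r k C -> koszul r k' C
  then fun c => (tau k' c.1, opx (koszul r' k' C) r' (k' - k) (tau k' c.2))
  else id.
Arguments tau {B} r k k' C _.

Lemma tau_morph (B : nzRingType) r k k' (C : opcx B) :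
  (k <= k')%N -> morph 0 (tau r k k' C).
Proof.
move=> kk'; elim: r => [|r IH] /=; first by split=> // n v; rewrite addr0.
split.
- by move=> [? ?] [? ?] /=; rewrite !(morphB IH) linearB.
- move=> [u v] /=; rewrite /cone_dif /= (morphB IH) !(morph_dif IH).
  rewrite (morph_opx IH) linearB /= opx_dif; congr (_, _ - _).
  by rewrite !opxE -iterD subnK.
- by move=> j [? ?] /=; rewrite /cone_op /= !(morph_op IH) opx_op.
- by move=> p [? ?] /=; rewrite /cone_pr /= !(morph_pr IH) opx_pr.
- move=> n [u v] [/= du dv]; split => /=; first exact: (morph_deg IH).
  have -> : n + 0 + k'%:Z = n + k%:Z + (k' - k)%N%:Z by lia.
  by apply: deg_opx; rewrite -[n + _]addr0; exact: (morph_deg IH).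
Qed.

Lemma tau_id (B : nzRingType) r k (C : opcx B) c : tau r k k C c = c.
Proof. by elim: r c => //= r IH [u v] /=; rewrite !IH subnn. Qed.

Lemma tau_tau (B : nzRingType) r k k' k'' (C : opcx B) c :
  (k <= k')%N -> (k' <= k'')%N -> tau r k' k'' C (tau r k k' C c) = tau r k k'' C c.
Proof.
move=> kk' kk''; elim: r c => //= r IH [u v] /=; rewrite IH; congr pair.
rewrite (morph_opx (tau_morph r C kk'')) IH !opxE -iterD; congr iter; lia.
Qed.

Lemma tau_kmap (B B' : nzRingType) a r k k' (C : opcx B) (C' : opcx B')
  (f : C -> C') c : morph a f ->
  tau r k k' C' (kmap f c) = kmap f (tau r k k' C c).
Proof.
move=> fM; elim: r c => //= r IH [u v] /=; rewrite /cone_map /= !IH.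
by rewrite (morph_opx (kmap_morph r k' fM)).
Qed.

Section Van.
Variables (r : nat) (D : set nat).

Definition coc (B : nzRingType) k (C : opcx B) p n (c : koszul r k C) : Prop :=
  bideg _ p n c /\ dif _ c = 0.

(** Vanishing in bidegree [(p, n)] of the cohomology of the direct system of the
    Koszul complexes with exponents in [D]. With [D = setT] this is the Čech
    description of local cohomology; with [D = [set k]] it is the cohomology of
    a single Koszul complex. Both satisfy the same long exact sequence, which
    is therefore proved for arbitrary [D]. *)
Definition van (B : nzRingType) (C : opcx B) (p n : int) : Prop :=
  forall k, D k -> forall c : koszul r k C, coc p n c ->
  exists k' b, [/\ D k', (k <= k')%N, bideg _ (p - 1) n b &
    tau r k k' C c = dif (koszul r k' C) b].

(** Surjectivity of [h] on cohomology. It replaces the vanishing of the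
    cohomology of [C] in the long exact sequence when that cohomology is nonzero,
    as it is in degree zero. *)
Definition hsurj (B B' : nzRingType) (C : opcx B) (C' : opcx B') (h : C -> C')
    (p n : int) : Prop :=
  forall k, D k -> forall c' : koszul r k C', coc p n c' ->
  exists k' c b, [/\ D k', (k <= k')%N, @coc _ k' C p n c, bideg _ (p - 1) n b &
    tau r k k' C' c' = kmap h c + dif (koszul r k' C') b].

Lemma coc_tau (B : nzRingType) k k' (C : opcx B) p n c : (k <= k')%N ->
  @coc B k C p n c -> coc p n (tau r k k' C c).
Proof.
move=> kk' [hc dc]; have tM := tau_morph r C kk'; split.
  by rewrite -[n]addr0; exact: (morph_bideg tM).
by rewrite -(morph_dif tM) dc (morph0 tM).
Qed.

Section Les.
Variables (B B' B'' : nzRingType) (a : int) (Q : opcx B) (C : opcx B')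
    (C' : opcx B'') (i : Q -> C) (h : C -> C').
Hypothesis ih : ses a i h.

Let iM k : morph a (@kmap _ _ r k _ _ i) := kmap_morph r k (ses_i ih).
Let hM k : morph 0 (@kmap _ _ r k _ _ h) := kmap_morph r k (ses_h ih).
Let sesk k := kmap_ses r k ih.
Let tM (B : nzRingType) (X : opcx B) k k' kk' := @tau_morph B r k k' X kk'.

Let coc_i k p n (q : koszul r k Q) : bideg _ p n q -> dif _ (kmap i q) = 0 -> coc p n q.
Proof.
move=> hq dq; split=> //; apply: (ses_inj (sesk k) (bideg_dif hq).1).
by rewrite (morph_dif (iM k)).
Qed.

(** The next lemmas are the exactness of the long exact sequence of
    [0 -> Q -> C -> C' -> 0] at each of its three terms. Each equation between
    classes is realized at a larger exponent, so the proofs are the usual diagram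
    chases with transition maps inserted. *)
Lemma van_mid (p n : int) : van Q p n -> van C' p (n + a) -> van C p (n + a).
Proof.
move=> vQ vC k Dk c [hc dc].
have [|k1 [b' [D1 k1k hb' e1]]] := vC k Dk (kmap h c).
  split; first by rewrite -[n + a]addr0; exact: (morph_bideg (hM k)).
  by rewrite -(morph_dif (hM k)) dc (morph0 (hM k)).
have [b hb hbb'] := ses_surj_bideg (sesk k1) hb'.
have [hc1 dc1] := coc_tau k1k (conj hc dc).
have [||q hq iq] := ses_exact_bideg (sesk k1) (p := p) (n := n) (c := tau r k k1 C c - dif _ b).
- by apply: bideg_B => //; rewrite -[p](subrK 1); exact: bideg_dif.
- rewrite (morphB (hM k1)) (morph_dif (hM k1)) hbb' -(tau_kmap _ _ (ses_h ih)).
  by rewrite e1 subrr.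
have [|k2 [b2 [D2 k2k1 hb2 e2]]] := vQ k1 D1 q.
  by apply: coc_i => //; rewrite iq linearB /= dc1 dif_dif subr0.
have iqe : tau r k1 k2 C (kmap i q) = dif _ (kmap i b2).
  by rewrite (tau_kmap _ _ (ses_i ih)) e2 (morph_dif (iM k2)).
exists k2, (kmap i b2 + tau r k1 k2 C b); split=> //; first exact: leq_trans k2k1.
  apply: bideg_D; first exact: (morph_bideg (iM k2)).
  by rewrite -[n + a]addr0; exact: (morph_bideg (tM C k2k1)).
rewrite linearD /= -iqe -(morph_dif (tM C k2k1)) -(morphD (tM C k2k1)) iq subrK.
by rewrite tau_tau.
Qed.

Lemma van_hsurj (p n : int) : van Q (p + 1) n -> hsurj h p (n + a).
Proof.
move=> vQ k Dk c' [hc' dc'].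
have [c hc hcc'] := ses_surj_bideg (sesk k) hc'.
have [||q hq iq] := ses_exact_bideg (sesk k) (p := p + 1) (n := n) (c := dif _ c).
- exact: bideg_dif.
- by rewrite (morph_dif (hM k)) hcc'.
have [|k1 [b [D1 k1k hb e1]]] := vQ k Dk q.
  by apply: coc_i => //; rewrite iq dif_dif.
exists k1, (tau r k k1 C c - kmap i b), 0; split=> //.
- split.
    apply: bideg_B; first by rewrite -[n + a]addr0; exact: (morph_bideg (tM C k1k)).
    by rewrite -{1}[p](addrK 1); exact: (morph_bideg (iM k1)).
  rewrite linearB /= -(morph_dif (tM C k1k)) -iq (tau_kmap _ _ (ses_i ih)) e1.
  by rewrite (morph_dif (iM k1)) subrr.
- exact: bideg_0.
rewrite linear0 addr0 (morphB (hM k1)) -(tau_kmap _ _ (ses_h ih)) hcc'.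
by rewrite (ses_zero (sesk k1) hb.1) subr0.
Qed.

Lemma hsurj_van (p n : int) : hsurj h p (n + a) -> van C (p + 1) (n + a) -> van Q (p + 1) n.
Proof.
move=> sC vC k Dk q [hq dq].
have [|k1 [b [D1 k1k hb e1]]] := vC k Dk (kmap i q).
  split; first exact: (morph_bideg (iM k)).
  by rewrite -(morph_dif (iM k)) dq (morph0 (iM k)).
rewrite addrK in hb.
have [|k2 [c [b' [D2 k2k1 [hc dc] hb' e2]]]] := sC k1 D1 (kmap h b).
  split; first by rewrite -[n + a]addr0; exact: (morph_bideg (hM k1)).
  rewrite -(morph_dif (hM k1)) -e1 (tau_kmap _ _ (ses_i ih)).
  have tq : deg (koszul r k1 Q) n (tau r k k1 Q q).
    by rewrite -[n]addr0; exact: (morph_deg (tM Q k1k) hq.1).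
  exact: (ses_zero (sesk k1) tq).
have [b2 hb2 hbb'] := ses_surj_bideg (sesk k2) hb'.
have [||w hw iw] := ses_exact_bideg (sesk k2) (p := p) (n := n)
    (c := tau r k1 k2 C b - c - dif _ b2).
- apply: bideg_B; last by rewrite -[p](subrK 1); exact: bideg_dif.
  apply: bideg_B => //.
  by rewrite -[n + a]addr0; exact: (morph_bideg (tM C k2k1)).
- rewrite !(morphB (hM k2)) (morph_dif (hM k2)) hbb' -(tau_kmap _ _ (ses_h ih)).
  by rewrite e2 addrAC addrK subrr.
have kk2 := leq_trans k1k k2k1.
exists k2, w; split=> //; first by rewrite addrK.
apply/eqP; rewrite -subr_eq0; apply/eqP.
have tq : deg (koszul r k2 Q) n (tau r k k2 Q q).
  by rewrite -[n]addr0; exact: (morph_deg (tM Q kk2) hq.1).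
apply: (ses_inj (sesk k2) (n := n)).
  by apply: deg_B => //; exact: (deg_dif hw.1).
rewrite (morphB (iM k2)) (morph_dif (iM k2)) iw !linearB /= dif_dif dc !oppr0 !addr0.
rewrite -(tau_kmap _ _ (ses_i ih)) -(tau_tau _ k1k k2k1) e1.
by rewrite (morph_dif (tM C k2k1)) subrr.
Qed.

Lemma van_quot (p n : int) : van Q (p + 1) n -> van C p (n + a) -> van C' p (n + a).
Proof.
move=> /van_hsurj sC vC k Dk c' cc'.
have [k1 [c [b' [D1 k1k cc hb' e1]]]] := sC k Dk c' cc'.
have [k2 [b [D2 k2k1 hb e2]]] := vC k1 D1 c cc.
exists k2, (kmap h b + tau r k1 k2 C' b'); split=> //; first exact: leq_trans k2k1.
  apply: bideg_D; rewrite -[n + a]addr0; first exact: (morph_bideg (hM k2)).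
  exact: (morph_bideg (tM C' k2k1)).
rewrite linearD /= -(morph_dif (tM C' k2k1)) -(morph_dif (hM k2)) -e2.
by rewrite -(tau_kmap _ _ (ses_h ih)) -(morphD (tM C' k2k1)) -e1 tau_tau.
Qed.

Lemma van_hsurj0 (p n : int) : van C' p (n + a) -> hsurj h p (n + a).
Proof.
move=> vC k Dk c' cc'; have [k1 [b [D1 k1k hb e1]]] := vC k Dk c' cc'.
exists k1, 0, b; split=> //; last by rewrite (morph0 (hM k1)) add0r.
by split; [exact: bideg_0 | rewrite linear0].
Qed.

Lemma van_sub (p n : int) : van C' p (n + a) -> van C (p + 1) (n + a) -> van Q (p + 1) n.
Proof. by move=> v1 v2; apply: hsurj_van => //; exact: van_hsurj0. Qed.

End Les.
End Van.

(** * Coefficients in degree zero *)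

Section Leaf.
Variables (B : nzRingType) (V : lmodType B) (f : nat -> {linear V -> V}).
Variable P : int -> set V.
Hypothesis fC : forall i j v, f i (f j v) = f j (f i v).
Hypothesis P0 : forall n, P n 0.
Hypothesis PB : forall n u v, P n u -> P n v -> P n (u - v).
Hypothesis Pf : forall j n v, P n v -> P (n + 1) (f j v).

Definition leaf_dif (v : V) : V := 0.

Lemma leaf_dif_linear : linear leaf_dif.
Proof. by move=> a u v; rewrite /leaf_dif scaler0 addr0. Qed.

HB.instance Definition _ := GRing.isLinear.Build B V V *:%R leaf_dif leaf_dif_linear.

Definition leaf_pr (p : int) (v : V) : V := if p == 0 then v else 0.

Lemma leaf_pr_linear p : linear (leaf_pr p).
Proof.
by rewrite /leaf_pr => a u v; case: ifP => // _; rewrite scaler0 addr0.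
Qed.

HB.instance Definition _ p :=
  GRing.isLinear.Build B V V *:%R (leaf_pr p) (leaf_pr_linear p).

Definition leaf : opcx B.
Proof.
refine (@Opcx B V leaf_dif f leaf_pr P _ _ fC _ _ _ P0 PB _ Pf _).
- by [].
- by move=> j v /=; rewrite /leaf_dif linear0.
- by move=> p v /=; rewrite /leaf_pr; case: (p == 0).
- by move=> p v /=; rewrite /leaf_pr /leaf_dif; case: (p == 0); case: (p + 1 == 0).
- by move=> j p v /=; rewrite /leaf_pr; case: ifP => // _; rewrite linear0.
- by move=> n v _; exact: P0.
- by move=> p n v Pv /=; rewrite /leaf_pr; case: (p == 0).
Defined.

End Leaf.

Definition concentrated (B : nzRingType) (C : opcx B) : Prop :=
  (forall v, dif C v = 0) /\ (forall p v, pr C p v = if p == 0 then v else 0).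

Fixpoint cochain0 (B : nzRingType) (r k : nat) (C : opcx B) (v : C) : koszul r k C :=
  if r is r'.+1 return koszul r k C then (cochain0 r' k v, 0) else v.

Lemma opx_cone (B : nzRingType) (C : opcx B) j e i k (c : cone j e C) :
  opx _ i k c = (opx C i k c.1, opx C i k c.2) :> C * C.
Proof. by case: c => u v; rewrite !opxE; elim: k => //= k ->. Qed.

Section Kin.
Variables (B : nzRingType) (C : opcx B).

Lemma cochain0_inj r k : injective (@cochain0 B r k C).
Proof. by elim: r => //= r IH u v [/IH]. Qed.

Lemma cochain0_0 r k : cochain0 r k (0 : C) = 0.
Proof. by elim: r => //= r ->. Qed.

Lemma cochain0_opx r k j e (v : C) : opx _ j e (cochain0 r k v) = cochain0 r k (opx C j e v).
Proof.
rewrite !opxE; elim: e => //= e ->; set w := iter _ _ _.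
by elim: r => //= r IH; rewrite /cone_op /= IH linear0.
Qed.

Lemma cochain0_deg r k n (v : C) : deg _ n (cochain0 r k v) <-> deg C n v.
Proof.
elim: r => //= r IH; rewrite -IH; split; first by case.
by split=> //; exact: deg_0.
Qed.

Lemma cochain0_pr r k p (v : C) : pr _ p (cochain0 r k v) = cochain0 r k (pr C p v).
Proof. by elim: r => //= r IH; rewrite /cone_pr /= IH linear0. Qed.

Lemma cochain0_dif r k (v : C) :
  dif _ (cochain0 r k v) = 0 <-> dif C v = 0 /\ forall j, (j < r)%N -> opx C j k v = 0.
Proof.
elim: r => [|r IH] /=; first by split=> // -[].
rewrite /cone_dif /= linear0 subr0 cochain0_opx; split.
  move=> [/IH[dv xv] xr]; split=> // j; rewrite ltnS leq_eqVlt => /predU1P[->|]; last exact: xv.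
  by apply: (@cochain0_inj r k); rewrite xr cochain0_0.
move=> [dv xv]; rewrite xv // cochain0_0; congr pair; apply/IH; split=> // j jr.
by apply: xv; exact: ltnW.
Qed.

Lemma tau_cochain0 r k k' (v : C) : (k <= k')%N -> tau r k k' C (cochain0 r k v) = cochain0 r k' v.
Proof.
by move=> kk'; elim: r => //= r ->; rewrite (morph0 (tau_morph r C kk')) linear0.
Qed.

Lemma kmap_cochain0 (B' : nzRingType) (C' : opcx B') a (h : C -> C') r k v :
  morph a h -> kmap h (cochain0 r k v) = cochain0 r k (h v).
Proof.
move=> hM; elim: r => //= r IH; rewrite /cone_map /= IH.
by rewrite (morph0 (kmap_morph r k hM)).
Qed.

Lemma koszul_opx0 r k j e : (forall v, opx C j e v = 0) ->
  forall c : koszul r k C, opx _ j e c = 0.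
Proof. by move=> Cj; elim: r => //= r IH c; rewrite opx_cone !IH. Qed.

Lemma koszul_deg_eq0 r k (m : int) : (forall n, m <= n -> forall v, deg C n v -> v = 0) ->
  forall n, m <= n -> forall c : koszul r k C, deg _ n c -> c = 0.
Proof.
move=> Cm; elim: r => //= r IH n mn [u v] [/= du dv].
by rewrite (IH _ mn _ du) (IH (n + k%:Z) _ _ dv) //; lia.
Qed.

Hypothesis Cc : concentrated C.

Lemma koszul_pr_neg r k p (c : koszul r k C) : p < 0 -> pr _ p c = c -> c = 0.
Proof.
elim: r p c => [|r IH] p c p0 /=; first by rewrite Cc.2 lt_eqF.
by case: c => u v [/(IH _ _ p0) -> /IH ->] //; lia.
Qed.

Lemma koszul_pr0 r k (c : koszul r k C) : pr _ 0 c = c -> exists v, c = cochain0 r k v.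
Proof.
elim: r c => [|r IH] c /=; first by exists c.
by case: c => u v [/IH[w ->] /koszul_pr_neg ->] //; exists w.
Qed.

(** The components of a cochain of bidegree [(q, n)] have internal degree
    [n + q * k] in [C]. *)
Lemma koszul_low r k : (forall n, n < 0 -> forall v, deg C n v -> v = 0) ->
  forall (q n : int) (c : koszul r k C), bideg _ q n c -> n + q * k%:Z < 0 -> c = 0.
Proof.
move=> Clow; elim: r => [|r IH] q n c.
  move=> [dc /=]; rewrite Cc.2; case: eqP => [->|_ <- //] _; rewrite mul0r addr0.
  by move=> n0; exact: Clow dc.
case: c => u v /cone_bideg[hu hv] qn; rewrite (IH _ _ _ hu qn) (IH _ _ _ hv) //.
by rewrite mulrBl mul1r addrCA addrA; move: qn; lia.
Qed.

Lemma coc0P r k n (c : koszul r k C) : coc 0 n c <->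
  exists v, [/\ c = cochain0 r k v, deg C n v & forall j, (j < r)%N -> opx C j k v = 0].
Proof.
split=> [[[dc /koszul_pr0[v cv]]]|[v [-> dv xv]]].
  by rewrite cv in dc * => /cochain0_dif[_ ?]; exists v; split=> //; exact/(cochain0_deg r k).
split; last by apply/cochain0_dif; split=> //; rewrite Cc.1.
by split; [apply/cochain0_deg | rewrite cochain0_pr Cc.2].
Qed.

(** A component of nonzero cohomological degree is indexed by a nonempty set of
    operators, so a transition map multiplies it by a power of one of them. *)
Lemma tau_nil r N : (forall j, (j < r)%N -> forall v, opx C j N v = 0) ->
  forall k p (c : koszul r k C), p != 0 -> pr _ p c = c -> tau r k (k + N) C c = 0.
Proof.
elim: r => [|r IH] xN k p c p0 /=; first by rewrite Cc.2 (negbTE p0).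
case: c => u v [pu pv] /=; rewrite (IH _ k p) // => [|j jr]; last exact/xN/ltnW.
by rewrite addKn koszul_opx0 // => w; exact: xN.
Qed.

Lemma van_nil r N p n : (forall j, (j < r)%N -> forall v, opx C j N v = 0) ->
  p != 0 -> van r setT C p n.
Proof.
move=> xN p0 k _ c [[_ pc] _]; exists (k + N)%N, 0; split=> //.
- exact: leq_addr.
- exact: bideg_0.
by rewrite linear0; apply: tau_nil pc.
Qed.

(** The transition map from [k'] to [k'.+1] multiplies the component at a set of
    operators by every operator of that set. So a cochain of nonzero degree whose
    products with the operators die in the direct system dies there itself. *)
Lemma tau_op_eq0 r k k' p (c : koszul r k C) : (k <= k')%N -> p != 0 -> pr _ p c = c ->
  (forall j, (j < r)%N -> tau r k k' C (op _ j c) = 0) -> tau r k k'.+1 C c = 0.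
Proof.
move=> kk' p0; elim: r c => [|r IH] c /=; first by rewrite Cc.2 (negbTE p0).
case: c => u v [pu pv] xc /=; rewrite IH // => [|j jr]; last first.
  by have [] := xc j (ltnW jr).
congr pair; have [_] := xc r (ltnSn r).
rewrite (morph_op (tau_morph r C kk')) => xv.
have kk1 : (k' <= k'.+1)%N by [].
rewrite -(tau_tau v kk' kk1) subSn // !opxE iterSr -!opxE.
have tM := tau_morph r C kk1.
by rewrite -(morph_op tM) -(morph_opx tM) xv (morph0 tM).
Qed.

End Kin.

(** * Graded modules and extension of maps into graded injectives *)

(** Subtracting the sum from its term of index [n] leaves a vanishing sum of
    homogeneous elements of distinct degrees. *)
Lemma grading_sum (V : zmodType) (P : int -> set V) (s : seq int) (f : int -> V)
  n : is_grading P -> uniq s -> (forall m, P m (f m)) -> P n (\sum_(m <- s) f m) ->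
  \sum_(m <- s) f m = if n \in s then f n else 0.
Proof.
move=> [P0 PB _ Puniq] us Pf Pn.
pose g m := if m == n then f n - \sum_(m <- s) f m else f m.
have Pg m : P m (g m) by rewrite /g; case: eqP => // ->; exact: PB.
case: ifPn => ns.
  have g0 : \sum_(m <- s) g m = 0.
    rewrite (bigD1_seq n) //= [g n]/g eqxx.
    rewrite [X in _ + X](_ : _ = \sum_(m <- s | m != n) f m); last first.
      by apply: eq_bigr => m /negbTE mn; rewrite /g mn.
    by rewrite addrAC -(bigD1_seq n) //= subrr.
  have := Puniq s g us Pg g0 n ns; rewrite /g eqxx => /eqP.
  by rewrite subr_eq0 => /eqP.
have gf : \sum_(m <- s) g m = \sum_(m <- s) f m.
  by rewrite [LHS]big_seq [RHS]big_seq; apply: eq_bigr => m ms;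
     rewrite /g; case: eqP => // mn; rewrite -mn ms in ns.
pose g' m := if m == n then - \sum_(m <- s) f m else f m.
have Pg' m : P m (g' m).
  by rewrite /g'; case: eqP => // ->; rewrite -sub0r; exact: PB.
have g'0 : \sum_(m <- n :: s) g' m = 0.
  rewrite big_cons [g' n]/g' eqxx.
  rewrite [X in _ + X](_ : _ = \sum_(m <- s) f m) ?addNr //.
  rewrite [LHS]big_seq [RHS]big_seq; apply: eq_bigr => m ms.
  by rewrite /g'; case: eqP => // mn; rewrite -mn ms in ns.
have /= := Puniq (n :: s) g' _ Pg' g'0 n (mem_head _ _).
by rewrite ns us /g' eqxx => /(_ isT)/eqP; rewrite oppr_eq0 => /eqP.
Qed.

(** Repeated indices are merged by scaling each term by its multiplicity. *)
Lemma grading_uniq (V : zmodType) (P : int -> set V) v : is_grading P ->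
  exists (s : seq int) (f : int -> V), [/\ uniq s, forall m, P m (f m) &
    v = \sum_(m <- s) f m].
Proof.
move=> [P0 PB Pex _]; have [s [f [Pf ->]]] := Pex v.
have PD n a b : P n a -> P n b -> P n (a + b).
  by by move=> Pa Pb; rewrite -[b]opprK -[- b]sub0r; do 2! [apply: (PB) => //].
exists (undup s), (fun n => f n *+ count_mem n s); split; first exact: undup_uniq.
  by move=> n; elim: (count_mem n s) => [|c IH]; rewrite ?mulr0n // mulrS; exact: PD.
by rewrite -big_undup_iterop_count /=; apply: eq_bigr => n _; rewrite Monoid.iteropE iter_addr_0.
Qed.

Lemma grading_shift (V : zmodType) (P : int -> set V) a :
  is_grading P -> is_grading (fun n => P (n + a)).
Proof.
move=> [P0 PB Pex Puniq]; split=> // [n|v|s f us Pf fs n ns]; first exact: PB.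
- have [s [f [Pf ->]]] := Pex v.
  exists [seq m - a | m <- s], (fun m => f (m + a)); split=> // .
  by rewrite big_map; apply: eq_bigr => m _; rewrite subrK.
- have /= := Puniq [seq m + a | m <- s] (fun m => f (m - a)).
  rewrite map_inj_uniq //; last exact: addIr.
  move=> /(_ us) H; rewrite -(addrK a n); apply: H.
  + by move=> m; have := Pf (m - a); rewrite subrK.
  + by rewrite big_map -[RHS]fs; apply: eq_bigr => m _; rewrite addrK.
  + exact: map_f.
Qed.

Lemma grading_prod (V W : zmodType) (P : int -> set V) (Q : int -> set W) :
  is_grading P -> is_grading Q ->
  is_grading (fun n => [set c : (V * W)%type | P n c.1 /\ Q n c.2]).
Proof.
move=> gP gQ; have [P0 PB _ Pu] := gP; have [Q0 QB _ Qu] := gQ.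
split=> [n|n x y [Px Qx] [Py Qy]|[v w]|s f us Pf fs n ns].
- by split.
- by split; [exact: PB | exact: QB].
- have [s [f [us Pf ->]]] := grading_uniq v gP.
  have [t [g [ut Qg ->]]] := grading_uniq w gQ.
  exists (undup (s ++ t)), (fun m => (if m \in s then f m else 0, if m \in t then g m else 0)).
  split; first by move=> m; split=> /=; case: ifP.
  rewrite [RHS]surjective_pairing !raddf_sum /=; congr pair.
    rewrite -big_mkcond -[RHS]big_filter; apply: perm_big; apply: uniq_perm => //.
      exact/filter_uniq/undup_uniq.
    by move=> m; rewrite mem_filter mem_undup mem_cat; case: (m \in s).
  rewrite -big_mkcond -[RHS]big_filter; apply: perm_big; apply: uniq_perm => //.
    exact/filter_uniq/undup_uniq.
  by move=> m; rewrite mem_filter mem_undup mem_cat orbC; case: (m \in t).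
- have f1 : \sum_(m <- s) (f m).1 = 0 by have := congr1 fst fs; rewrite raddf_sum.
  have f2 : \sum_(m <- s) (f m).2 = 0 by have := congr1 snd fs; rewrite raddf_sum.
  rewrite [f n]surjective_pairing.
  by rewrite (Pu s _ us (fun m => (Pf m).1) f1 n ns) (Qu s _ us (fun m => (Pf m).2) f2 n ns).
Qed.

Lemma koszul_grading (B : nzRingType) (C : opcx B) r k :
  is_grading (deg C) -> is_grading (deg (koszul r k C)).
Proof.
by move=> gC; elim: r => //= r IH; exact: (grading_prod IH (grading_shift k%:Z IH)).
Qed.

Section Image.
Variables (S : comNzRingType) (U V : lmodType S) (f : {linear U -> V}).

Definition im_pred : {pred V} := fun v => `[< exists u, f u = v >].

Lemma im_closed : submod_closed im_pred.
Proof.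
split; first by apply/asboolP; exists 0; rewrite linear0.
move=> a _ _ /asboolP[u <-] /asboolP[v <-]; apply/asboolP.
by exists (a *: u + v); rewrite linearP.
Qed.

HB.instance Definition _ := GRing.isSubmodClosed.Build S V im_pred im_closed.

Record im := Im { im_val :> V; _ : im_val \in im_pred }.

HB.instance Definition _ := [isSub for im_val].
HB.instance Definition _ := [Choice of im by <:].
HB.instance Definition _ := [SubChoice_isSubLmodule of im by <:].

Lemma im_valP (w : im) : exists u, f u = im_val w.
Proof. by case: w => w /= /asboolP. Qed.

Lemma im_memP u : f u \in im_pred.
Proof. by apply/asboolP; exists u. Qed.

Lemma im_val_linear : linear im_val.
Proof. by []. Qed.

HB.instance Definition _ := GRing.isLinear.Build S im V *:%R im_val im_val_linear.

End Image.

Section Extension.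
Variables (S : gradedRing) (N1 N2 : gradedModule S) (f : {linear N1 -> N2}).
Hypothesis fG : is_graded f.

Definition im_comp (n : int) : set (im f) := [set w | gm_comp n (im_val w)].

Lemma im_grading : is_grading im_comp.
Proof.
have [P0 PB _ Puniq] := gm_grading N2.
split=> [n|n v w Pv Pw|w|s g us Pg gs n ns].
- exact: P0.
- exact: (PB _ _ _ Pv Pw).
- have [u fu] := im_valP w; have [s [g [_ Pg us]]] := grading_uniq u (gm_grading N1).
  exists s, (fun m => Im (im_memP f (g m))); split; first by move=> m; exact: fG.
  by apply: val_inj; rewrite /= -[LHS]fu us !linear_sum.
- apply: val_inj.
  apply: (Puniq s (fun m => im_val (g m))) => //.
  by rewrite -linear_sum gs linear0.
Qed.

Lemma im_scale (m : nat) (n : int) (a : S) w :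
  @gr_comp S m a -> im_comp n w -> im_comp (m%:Z + n) (a *: w).
Proof. by move=> Sa Pw; exact: gm_scale Sa Pw. Qed.

Definition im_graded : gradedModule S := GradedModule im_grading im_scale.

(** A map that kills the homogeneous elements of the kernel of [f] kills this
    kernel, so it factors through the image of [f], a graded submodule of [N2] to
    which injectivity applies. *)
Lemma graded_injective_extend (E : gradedModule S) (phi : {linear N1 -> E}) :
  graded_injective E -> is_graded phi ->
  (forall n t, gm_comp n t -> f t = 0 -> phi t = 0) ->
  exists2 psi : {linear N2 -> E}, is_graded psi & forall t, psi (f t) = phi t.
Proof.
move=> injE phiG ker_phi.
have ker t : f t = 0 -> phi t = 0.
  have [s [g [us Pg ->]]] := grading_uniq t (gm_grading N1).
  rewrite !linear_sum => fs; rewrite big_seq big1 // => n ns.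
  apply: (ker_phi n) => //.
  have [_ _ _ /(_ s (fun m => f (g m)) us)] := gm_grading N2.
  by apply=> // m; exact: fG.
have /choice[lift liftP] : forall w : im f, exists u, f u = im_val w by exact: im_valP.
have phi_eq u v : f u = f v -> phi u = phi v.
  by move=> fuv; apply/eqP; rewrite -subr_eq0 -linearB ker // linearB /= fuv subrr.
pose g (w : im_graded) : E := phi (lift w).
have gL : linear g.
  move=> a u v; rewrite /g -linearP; apply: phi_eq.
  by rewrite liftP !linearP /= !liftP.
pose G : {linear im_graded -> E} := HB.pack g (GRing.isLinear.Build _ _ _ _ g gL).
pose J : {linear im_graded -> N2} := @im_val _ _ _ f.
have [|||psi psiG psiE] := injE im_graded N2 J G.
- exact: val_inj.
- by [].
- move=> n w; rewrite /= /im_comp /= /g -liftP.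
  have [s [h [us Ph ->]]] := grading_uniq (lift w) (gm_grading N1).
  rewrite linear_sum => /(grading_sum (gm_grading N2) us (fun m => fG (Ph m))).
  rewrite -(linear_sum f).
  case: ifP => _ fs; last first.
    by rewrite ker //; have [P0 _ _ _] := gm_grading E; exact: P0.
  by rewrite (phi_eq _ _ fs); apply: phiG.
- exists psi => // t; have := psiE (Im (im_memP f t)).
  by rewrite /= => ->; apply: phi_eq; rewrite liftP.
Qed.

End Extension.

(** * Self-duality of the Koszul complex and acyclicity of graded injectives *)

Section ModuleComplex.
Variables (S : gradedRing) (x : nat -> S).
Hypothesis x1 : forall j, @gr_comp S 1%N (x j).

Section Def.
Variable M : gradedModule S.

Definition mulx (j : nat) (v : M) : M := x j *: v.

Lemma mulx_linear j : linear (mulx j).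
Proof. by move=> a u v; rewrite /mulx scalerDr !scalerA mulrC. Qed.

HB.instance Definition _ j := GRing.isLinear.Build S M M *:%R (mulx j) (mulx_linear j).

Lemma mulx_comm i j v : mulx i (mulx j v) = mulx j (mulx i v).
Proof. by rewrite /mulx !scalerA mulrC. Qed.

(** The components are a parameter, rather than those of [M], so that graded
    subgroups of [M] give complexes without forming submodules. *)
Definition famC (P : int -> set M) (P0 : forall n, P n 0)
    (PB : forall n u v, P n u -> P n v -> P n (u - v))
    (Px : forall j n v, P n v -> P (n + 1) (x j *: v)) : opcx S :=
  @leaf S M mulx P mulx_comm P0 PB Px.

Lemma mod_comp0 n : gm_comp n (0 : M).
Proof. by have [] := gm_grading M. Qed.

Lemma mod_compB n (u v : M) : gm_comp n u -> gm_comp n v -> gm_comp n (u - v).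
Proof. by have [_ + _ _] := gm_grading M; exact. Qed.

Lemma mod_compx j n (v : M) : gm_comp n v -> gm_comp (n + 1) (x j *: v).
Proof. by rewrite addrC; exact: gm_scale. Qed.

Definition modC : opcx S := famC mod_comp0 mod_compB mod_compx.

End Def.

Notation RC := (modC (regular S)).

Lemma koszul_op (M : gradedModule S) r k j (c : koszul r k (modC M)) : op _ j c = x j *: c.
Proof. by elim: r c => //= r IH [u v]; rewrite /cone_op /= !IH. Qed.

Lemma koszul_opx (M : gradedModule S) r k j e (c : koszul r k (modC M)) :
  opx _ j e c = x j ^+ e *: c.
Proof.
by rewrite opxE; elim: e => [|e /= ->]; rewrite ?scale1r // koszul_op scalerA exprS.
Qed.

Lemma koszul_scale (M : gradedModule S) r k (m : nat) n (s : S) (c : koszul r k (modC M)) :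
  @gr_comp S m s -> deg _ n c -> deg _ (m%:Z + n) (s *: c).
Proof.
move=> Ss; elim: r n c => [|r IH] n c /=; first exact: gm_scale.
case: c => u v [du dv]; split=> /=; first exact: IH.
by rewrite -addrA; exact: IH.
Qed.

(** The dual transition map: it multiplies the component indexed by a set of
    operators by the powers of the operators outside that set. *)
Fixpoint tau_dual r k k' (C : opcx S) : koszul r k' C -> koszul r k C :=
  if r is r'.+1 return koszul r k' C -> koszul r k C
  then fun c => (opx (koszul r' k C) r' (k' - k) (@tau_dual r' k k' C c.1),
                 @tau_dual r' k k' C c.2)
  else id.
Arguments tau_dual : clear implicits.

Lemma tau_dual_morph r k k' (C : opcx S) : (k <= k')%N ->
  morph (r * (k' - k))%N%:Z (tau_dual r k k' C).
Proof.
move=> kk'; elim: r => [|r IH] /=; first by split=> // n v; rewrite addr0.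
split.
- by move=> [? ?] [? ?] /=; rewrite !(morphB IH) linearB.
- move=> [u v] /=; rewrite /cone_dif /= (morphB IH) !(morph_dif IH) opx_dif.
  rewrite (morph_opx IH); congr (_, _ - _).
  by rewrite !opxE -iterD subnKC.
- by move=> j [? ?] /=; rewrite /cone_op /= !(morph_op IH) opx_op.
- by move=> p [? ?] /=; rewrite /cone_pr /= !(morph_pr IH) opx_pr.
- move=> n [u v] [/= du dv]; split => /=.
    have -> : n + (r.+1 * (k' - k))%N%:Z = n + (r * (k' - k))%N%:Z + (k' - k)%N%:Z by lia.
    by apply: deg_opx; exact: (morph_deg IH).
  have -> : n + (r.+1 * (k' - k))%N%:Z + k%:Z = n + k'%:Z + (r * (k' - k))%N%:Z by lia.
  exact: (morph_deg IH).
Qed.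

Section Pairing.
Variables (E : gradedModule S).

(** The pairing matching the component at a set of operators with the component
    at its complement; its signs make the differential adjoint to itself up to
    sign. Through it, a cochain with values in [E] is the same thing as a linear
    map from the Koszul complex of the ring to [E]. *)
Fixpoint pair r k : koszul r k RC -> koszul r k (modC E) -> E :=
  if r is r'.+1 return koszul r k RC -> koszul r k (modC E) -> E
  then fun t c => pair t.1 c.2 + (-1) ^+ r'.+1 *: pair t.2 c.1
  else fun t c => (t : S) *: c.

Lemma pair_linearr r k t : linear (@pair r k t).
Proof.
elim: r t => [|r IH] t a u v /=; first by rewrite scalerDr !scalerA mulrC.
by rewrite !IH [a *: (_ + _)]scalerDr [_ *: (_ + _)]scalerDr !scalerA [a * _]mulrC addrACA.
Qed.

HB.instance Definition _ r k t :=
  GRing.isLinear.Build S (koszul r k (modC E)) E *:%R (@pair r k t) (@pair_linearr r k t).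

Definition pairl r k c t := @pair r k t c.

Lemma pair_linearl r k c : linear (@pairl r k c).
Proof.
rewrite /pairl; elim: r c => [|r IH] c a u v /=; first by rewrite scalerDl scalerA.
by rewrite !IH [a *: (_ + _)]scalerDr [_ *: (_ + _)]scalerDr !scalerA [a * _]mulrC addrACA.
Qed.

HB.instance Definition _ r k c :=
  GRing.isLinear.Build S (koszul r k RC) E *:%R (@pairl r k c) (@pair_linearl r k c).

Lemma pairZl r k a t c : @pair r k (a *: t) c = a *: pair t c.
Proof. exact: (linearZ_LR (@pairl r k c)). Qed.

Lemma pairBl r k t u c : @pair r k (t - u) c = pair t c - pair u c.
Proof. exact: (linearB (@pairl r k c)). Qed.

Lemma pair0l r k c : @pair r k 0 c = 0.
Proof. exact: (linear0 (@pairl r k c)). Qed.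

Lemma pair_dif r k t c :
  @pair r k t (dif _ c) = (-1) ^+ r *: pair (dif _ t) c.
Proof.
elim: r t c => [|r IH] /=; first by move=> t c; rewrite /leaf_dif scaler0 scale0r scaler0.
move=> [a b] [c e] /=; rewrite linearB pairBl /= !IH !koszul_opx linearZ pairZl /=.
set X := pair a c; set Y := pair (dif _ a) e; set Z := pair (dif _ b) c.
have s2 : (-1 : S) ^+ r.+1 * (-1) ^+ r.+1 = 1 by rewrite -exprMn mulrNN mulr1 expr1n.
rewrite exprS mulN1r in s2 *; set s : S := (-1) ^+ r in s2 *.
rewrite mulrNN in s2.
rewrite [RHS]scalerDr [in RHS]scalerA mulrNN s2 scale1r !scaleNr scalerA s2 scale1r.
by rewrite addrA [- _ + _]addrC.
Qed.

Lemma pair_tau r k k' t c : (k <= k')%N ->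
  @pair r k' t (tau r k k' _ c) = pair (tau_dual r k k' _ t) c.
Proof.
move=> kk'; elim: r t c => //= r IH [a b] [c e] /=.
by rewrite !koszul_opx linearZ pairZl /= !IH.
Qed.

Lemma pair_pr r k p t c : pr _ p c = c -> @pair r k t c = pair (pr _ (r%:Z - p) t) c.
Proof.
elim: r p t c => [|r IH] p t c /=.
  rewrite /leaf_pr; case: eqP => [->|_ <-]; first by rewrite subr0 eqxx.
  by rewrite !scaler0.
case: t c => [a b] [c e] [pc pe] /=; rewrite (IH _ a _ pe) (IH _ b _ pc).
have -> : r.+1%:Z - p = r%:Z - (p - 1) by lia.
by have -> : r%:Z - (p - 1) - 1 = r%:Z - p by lia.
Qed.

Lemma pair_deg r k m n t c : deg _ m t -> deg _ n c ->
  @gm_comp S E (m + n + (r * k)%N%:Z) (@pair r k t c).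
Proof.
have [P0 PB _ _] := gm_grading E.
elim: r m n t c => [|r IH] m n t c /=.
  rewrite addr0; case: m => [m|m] mt nc; first exact: gm_scale.
  by move: mt; rewrite /regular_comp /= => ->; rewrite scale0r; exact: P0.
case: t c => [a b] [c e] [/= da db] [/= dc de].
have e1 : m + n + (r.+1 * k)%N%:Z = m + (n + k%:Z) + (r * k)%N%:Z by lia.
have e2 : m + n + (r.+1 * k)%N%:Z = m + k%:Z + n + (r * k)%N%:Z by lia.
have Pa : gm_comp (m + n + (r.+1 * k)%N%:Z) (pair a e) by rewrite e1; exact: IH.
have Pb : gm_comp (m + n + (r.+1 * k)%N%:Z) (pair b c) by rewrite e2; exact: IH.
rewrite -signr_odd; case: odd; rewrite ?expr0 ?expr1 ?scaleN1r ?scale1r; first exact: PB.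
by rewrite -[pair b c]opprK -[- pair b c]sub0r; do 2! [apply: (PB) => //].
Qed.

Lemma pair_nondeg r k c : (forall t, @pair r k t c = 0) -> c = 0.
Proof.
elim: r c => [|r IH] c /=; first by move=> /(_ 1); rewrite scale1r.
case: c => c e tc; have e0 : e = 0.
  apply: IH => t; have := tc (t, 0) => /=.
  by rewrite pair0l scaler0 addr0.
rewrite e0; congr (_, _); apply: IH => t; have := tc (0, t) => /=.
rewrite pair0l add0r => /(congr1 (fun z => (-1) ^+ r.+1 *: z)).
by rewrite scalerA -exprMn mulrNN mulr1 expr1n scale1r scaler0.
Qed.

(** By induction on [r]: the restrictions of the map to the two summands of a
    cone are pairings. *)
Lemma pair_repr r k n (psi : {linear koszul r k RC -> E}) :
  (forall m t, deg _ m t -> @gm_comp S E (m + n + (r * k)%N%:Z) (psi t)) ->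
  exists2 y, deg _ n y & forall t, psi t = @pair r k t y.
Proof.
have [P0 PB _ _] := gm_grading E.
elim: r n psi => [|r IH] n psi psiG.
  exists (psi (1 : S)) => [|t] /=.
    by have := psiG 0 1 (@gr_one S); rewrite add0r addr0.
  by rewrite -[RHS](linearZ_LR psi) /=; congr (psi _); exact: esym (mulr1 _).
pose psi1 (a : koszul r k RC) := psi (a, 0).
pose psi2 (b : koszul r k RC) := (-1) ^+ r.+1 *: psi (0, b).
have L1 : linear psi1.
  move=> s a b; rewrite /psi1 -linearP; congr (psi _).
  by congr (_, _); rewrite /= scaler0 addr0.
have L2 : linear psi2.
  move=> s a b; rewrite /psi2 scalerA mulrC -scalerA -scalerDr -linearP.
  by congr (_ *: psi _); congr (_, _); rewrite /= scaler0 addr0.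
pose Psi1 : {linear koszul r k RC -> E} := HB.pack psi1 (GRing.isLinear.Build _ _ _ _ psi1 L1).
pose Psi2 : {linear koszul r k RC -> E} := HB.pack psi2 (GRing.isLinear.Build _ _ _ _ psi2 L2).
have [m a da|e de eE] := IH (n + k%:Z) Psi1.
  have -> : m + (n + k%:Z) + (r * k)%N%:Z = m + n + (r.+1 * k)%N%:Z by lia.
  by apply: psiG; split=> //; exact: deg_0.
have [m b db|c dc cE] := IH n Psi2.
  have -> : m + n + (r * k)%N%:Z = m - k%:Z + n + (r.+1 * k)%N%:Z by lia.
  have Pb : gm_comp (m - k%:Z + n + (r.+1 * k)%N%:Z) (psi (0, b)).
    by apply: psiG; split=> /=; [exact: deg_0 | rewrite subrK].
  rewrite /= /psi2 -signr_odd; case: odd; rewrite ?expr0 ?expr1 ?scaleN1r ?scale1r //.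
  by rewrite -[- psi _]sub0r; exact: PB.
exists (c, e) => // -[a b] /=.
have -> : (a, b) = (a, 0) + (0, b) :> koszul r.+1 k RC.
  by congr (_, _); rewrite /= ?addr0 ?add0r.
rewrite linearD -/(psi1 a) -[psi1 a]/(Psi1 a) eE -cE /= /psi2 scalerA -exprMn.
by rewrite mulrNN mulr1 expr1n scale1r.
Qed.

End Pairing.
End ModuleComplex.

Arguments tau_dual {S} r k k' C _.

Lemma van1P (B : nzRingType) (C : opcx B) r k p n : van r [set k] C p n <->
  forall c : koszul r k C, coc p n c -> exists2 b, bideg _ (p - 1) n b & c = dif _ b.
Proof.
split=> [vC c cc|vC _ -> c cc].
  have [k' [b [/= k'k _]]] := vC k erefl c cc; rewrite k'k in b * => hb.
  by rewrite tau_id => ->; exists b.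
by have [b hb ->] := vC c cc; exists k, b; split=> //; rewrite tau_id.
Qed.

Lemma van1_van (B : nzRingType) (C : opcx B) r p n :
  (forall k, van r [set k] C p n) -> van r setT C p n.
Proof.
move=> vC k _ c /(vC k k erefl)[k' [b [_ kk hb cb]]].
by exists k', b; split.
Qed.

Section InjectiveVan.
Variables (S : gradedRing) (x : nat -> S).
Hypothesis x1 : forall j, @gr_comp S 1%N (x j).
Notation RC := (modC x1 (regular S)).

Section Shift.
Variables (r k : nat) (a : int).

Definition kshift_comp (m : int) : set (koszul r k RC) := deg (koszul r k RC) (m + a).

Lemma kshift_grading : is_grading kshift_comp.
Proof. by apply: grading_shift; apply: koszul_grading; exact: gm_grading. Qed.

Lemma kshift_scale (m : nat) (n : int) (s : S) c :
  @gr_comp S m s -> kshift_comp n c -> kshift_comp (m%:Z + n) (s *: c).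
Proof. by rewrite /kshift_comp -addrA; exact: koszul_scale. Qed.

Definition kshift : gradedModule S := GradedModule kshift_grading kshift_scale.

End Shift.

(** A cocycle with values in [E] is, through the pairing, a linear map on the
    Koszul complex of the ring that kills coboundaries. Dual transition maps of
    that complex raise internal degrees above the bound [c0], and so turn cocycles
    of cohomological degree less than [r] into coboundaries. Hence a cocycle that has been moved far enough kills the
    kernel of the differential, and extends along it by injectivity; the extension
    is a cochain bounding it. *)
Lemma injective_van r c0 (E : gradedModule S) p n :
  (forall k q (m : int), c0 < m -> van r [set k] RC q m) ->
  graded_injective E -> 0 < p -> van r setT (modC x1 E) p n.
Proof.
move=> acyc injE p0 k _ c [[dc pc] zc].
(* A nonzero cochain on the ring of cohomological degree q < r has internal
   degree at least - q * k', hence at least - (r - 1) * k'. The dual transition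
   map adds r * (k' - k), so the degree becomes at least k' - r * k. *)
pose k' := (k + (`|c0| + r * k).+1)%N.
have kk' : (k <= k')%N by exact: leq_addr.
have tM := tau_morph r (modC x1 E) kk'; have uM := tau_dual_morph r RC kk'.
pose tc := tau r k k' _ c.
have dtc : deg (koszul r k' (modC x1 E)) n tc.
  by rewrite -[n]addr0; exact: (morph_deg tM).
have ptc : pr _ p tc = tc by rewrite -(morph_pr tM) pc.
have ker_phi m t : deg (koszul r k' RC) m t -> dif _ t = 0 -> pair t tc = 0.
  move=> dt zt; rewrite (pair_pr _ ptc).
  set q := r%:Z - p; set u := pr _ q t.
  have hu : bideg _ q m u by split; [exact: deg_pr | rewrite pr_pr].
  have zu : dif _ u = 0 by rewrite dif_pr zt linear0.
  have [mq|mq] := ltP (m + q * k'%:Z) 0.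
    rewrite (koszul_low _ _ hu mq) ?pair0l //.
    by case=> // l _ v.
  rewrite pair_tau //; set w := tau_dual _ _ _ _ _.
  have cw : coc q (m + (r * (k' - k))%N%:Z) w.
    split; first exact: (morph_bideg uM).
    by rewrite -(morph_dif uM) zu (morph0 uM).
  have [|b hb ->] := (van1P _ _ _ _ _).1 (acyc k q _ _) w cw.
    have qr : q * k'%:Z <= (r%:Z - 1) * k'%:Z by apply: ler_wpM2r; rewrite /q; lia.
    have : (r%:Z - 1) * k'%:Z = r%:Z * k'%:Z - k'%:Z by rewrite mulrBl mul1r.
    have e1 : (r * (k' - k))%N%:Z = r%:Z * k'%:Z - r%:Z * k%:Z.
      by rewrite -mulrBr PoszM subzn.
    have e2 : (r * k)%N%:Z = r%:Z * k%:Z by rewrite PoszM.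
    rewrite e1; have : k'%:Z = k%:Z + (`|c0|%N%:Z + (r * k)%N%:Z + 1) by rewrite /k'; lia.
    by rewrite e2; move: qr mq; lia.
  have := pair_dif b c; rewrite zc linear0 => /(congr1 (fun z => (-1) ^+ r *: z)).
  by rewrite scaler0 scalerA -exprMn mulrNN mulr1 expr1n scale1r.
pose a := - (n + (r * k')%N%:Z).
have difG : @is_graded _ (kshift r k' a) (kshift r k' a) (dif (koszul r k' RC)).
  by move=> m t; exact: deg_dif.
pose phi : {linear kshift r k' a -> E} := @pairl S x x1 E r k' tc.
have [|m t dt|psi psiG psiE] := graded_injective_extend difG (phi := phi) injE.
- move=> m t dt; have := pair_deg dt dtc.
  by rewrite (_ : _ + _ = m) // /a; lia.
- exact: ker_phi dt.
have [m t dt|y dy yE] := pair_repr (n := n) (psi := psi).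
  by apply: psiG; rewrite /kshift /= /kshift_comp /a (_ : _ + _ = m) //; lia.
exists k', ((-1) ^+ r *: pr _ (p - 1) y); split=> //.
  split; last by rewrite linearZ /= pr_pr.
  have := deg_pr (p - 1) dy; set z := pr _ _ _ => dz.
  rewrite -signr_odd; case: odd; rewrite ?expr0 ?expr1 ?scale1r ?scaleN1r //.
  exact: deg_N.
rewrite linearZ /= dif_pr subrK.
have -> : dif _ y = (-1) ^+ r *: tc.
  apply/eqP; rewrite -subr_eq0; apply/eqP; apply: (@pair_nondeg S x x1 E) => t.
  by rewrite linearB linearZ /= pair_dif -yE psiE /phi /= /pairl subrr.
by rewrite linearZ /= ptc scalerA -exprMn mulrNN mulr1 expr1n scale1r.
Qed.

End InjectiveVan.

(** * Local cohomology as the limit of Koszul cohomology *)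

Section ZeroComplex.
Variables (B : nzRingType) (C : opcx B).

Definition zeroC : opcx B.
Proof.
refine (@Opcx B C (dif C) (op C) (pr C) (fun=> [set 0]) _ _ _ _ _ _ _ _ _ _ _).
- exact: dif_dif.
- exact: dif_op.
- exact: op_op.
- exact: pr_pr.
- exact: dif_pr.
- exact: op_pr.
- by [].
- by move=> n u v /= -> ->; rewrite subrr.
- by move=> n v /= ->; rewrite linear0.
- by move=> j n v /= ->; rewrite linear0.
- by move=> p n v /= ->; rewrite linear0.
Defined.

End ZeroComplex.

Lemma van_deg_eq0 (B : nzRingType) (C : opcx B) r D p (n : int) :
  (forall m, n <= m -> forall v, deg C m v -> v = 0) -> van r D C p n.
Proof.
move=> C0 k Dk c [[dc _] _]; exists k, 0; split=> //; first exact: bideg_0.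
by rewrite (koszul_deg_eq0 C0 (lexx n) dc) tau_id linear0.
Qed.

(** Cohomology only sees the homogeneous elements: this is the long exact sequence
    with third term zero. *)
Lemma van_iso (B B' : nzRingType) a (Q : opcx B) (C : opcx B') (i : Q -> C) r D p n :
  morph a i ->
  (forall n c, deg C (n + a) c -> exists2 q, deg Q n q & i q = c) ->
  (forall n q, deg Q n q -> i q = 0 -> q = 0) ->
  van r D Q p n <-> van r D C p (n + a).
Proof.
move=> iM surj inj.
have S : @ses _ _ _ a Q C (zeroC C) i (fun=> 0).
  split=> //; last 1 first.
  - by move=> m c dc _; exact: surj.
  - split=> //.
    + by move=> *; rewrite subr0.
    + by move=> *; rewrite /= linear0.
    + by move=> *; rewrite /= linear0.
    + by move=> *; rewrite /= linear0.
  - by move=> m c' /= ->; exists 0 => //; exact: deg_0.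
have vz q m : van r D (zeroC C) q m by apply: van_deg_eq0.
split=> v; first exact: (van_mid S).
by rewrite -[p](subrK 1); apply: (van_sub S) => //; rewrite subrK.
Qed.

Section Comparison.
Variables (S : gradedRing) (x : nat -> S) (r : nat).
Hypothesis x1 : forall j, @gr_comp S 1%N (x j).
Local Notation Splus := (@irrelevant_ideal S).
(** The [x j] generate the irrelevant ideal up to radical. *)
Hypothesis x_pow : exists m, forall s, ideal_pow Splus m s ->
  exists t : nat -> S, s = \sum_(j < r) x j * t j.

Lemma torsion_succ (M : gradedModule S) (z : M) k :
  (forall s, ideal_pow Splus k s -> s *: z = 0) ->
  forall s, ideal_pow Splus k.+1 s -> s *: z = 0.
Proof.
move=> zk s [n [a [g [gP ->]]]]; rewrite scaler_suml big1 // => i _.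
have [u [v [_ vk ->]]] := gP i.
by rewrite -!scalerA zk // !scaler0.
Qed.

Lemma torsion_le (M : gradedModule S) (z : M) k k' : (k <= k')%N ->
  (forall s, ideal_pow Splus k s -> s *: z = 0) ->
  forall s, ideal_pow Splus k' s -> s *: z = 0.
Proof.
by move=> /subnK <- zk; elim: (k' - k)%N => //= d IH; exact: torsion_succ.
Qed.

Lemma torsion_add (M : gradedModule S) k m (z : M) :
  (forall s t, ideal_pow Splus m s -> ideal_pow Splus k t -> t *: (s *: z) = 0) ->
  forall s, ideal_pow Splus (m + k) s -> s *: z = 0.
Proof.
elim: m z => [|m IH] z zmk; first by move=> s sk; rewrite -[z]scale1r zmk.
move=> s [n [a [g [gP ->]]]]; rewrite scaler_suml big1 // => i _.
have [u [v [uS vk ->]]] := gP i.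
have -> : a i * (u * v) = v * (u * a i) by ring.
rewrite -scalerA (IH ((u * a i) *: z)) // => s1 t s1m tk.
have -> : t *: (s1 *: ((u * a i) *: z)) = a i *: (t *: ((u * s1) *: z)).
  by rewrite !scalerA; congr (_ *: _); ring.
rewrite zmk ?scaler0 //.
exists 1%N, (fun=> 1), (fun=> u * s1); split; last by rewrite big_ord1 mul1r.
by move=> _; exists u, s1.
Qed.

(** If [S_+ ^ m] is contained in the ideal of the [x j] and [S_+ ^ k] kills every
    [x j *: z], then [S_+ ^ (m + k)] kills [z]. *)
Lemma torsion_mulx (M : gradedModule S) (z : M) :
  (forall j, (j < r)%N -> torsion Splus (x j *: z)) -> torsion Splus z.
Proof.
move=> /= xz; have [m mP] := x_pow.
have [k kP] : exists k, forall j, (j < r)%N -> forall s, ideal_pow Splus k s ->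
    s *: (x j *: z) = 0.
  elim: (r) xz => [|r' IH] xz; first by exists 0%N.
  have [j jr|k kP] := IH; first exact/xz/ltnW.
  have [k' kP'] := xz r' (ltnSn r'); exists (maxn k k') => j.
  rewrite ltnS leq_eqVlt => /predU1P[->|jr]; first exact: torsion_le (leq_maxr _ _) kP'.
  exact: torsion_le (leq_maxl _ _) (kP j jr).
exists (m + k)%N; apply: torsion_add => s t /mP[c ->] tk.
rewrite scaler_suml scaler_sumr big1 // => j _.
have -> : t *: ((x j * c j) *: z) = c j *: (t *: (x j *: z)).
  by rewrite !scalerA; congr (_ *: _); ring.
by rewrite kP // scaler0.
Qed.

Lemma irrelevant_x j : Splus (x j).
Proof.
exists 1%N, (fun=> 1), (fun=> x j); split; last by rewrite big_ord1 mul1r.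
by move=> _; exists 1%N.
Qed.

(** For the converse, [torsion_mulx] lowers one exponent at a time, down to a zero
    exponent, which forces the element to vanish. *)
Lemma torsionP (M : gradedModule S) (z : M) : torsion Splus z <->
  exists k, forall j, (j < r)%N -> x j ^+ k *: z = 0.
Proof.
split=> [[k kP]|[k kP]].
  exists k => j _; apply: kP; elim: k => //= k IH; rewrite exprS.
  exists 1%N, (fun=> 1), (fun=> x j * x j ^+ k); split; last by rewrite big_ord1 mul1r.
  by move=> _; exists (x j), (x j ^+ k); split=> //; exact: irrelevant_x.
suff key : forall N (e : nat -> nat) (w : M), (\sum_(j < r) e j < N)%N ->
    (forall j, (j < r)%N -> x j ^+ e j *: w = 0) -> torsion Splus w.
  exact: (key _ (fun=> k) z (ltnSn _) kP).
elim=> // N IH e w ltN eP.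
have [/existsP[j /eqP ej]|/existsPn e0] := boolP [exists j : 'I_r, e j == 0%N].
  exists 0%N => s _; have := eP j (ltn_ord j).
  by rewrite ej expr0 scale1r => ->; rewrite scaler0.
apply: torsion_mulx => j jr; pose e' i := if i == j then (e i).-1 else e i.
apply: (IH e') => [|i ir].
  suff : (\sum_(i < r) e' i < \sum_(i < r) e i)%N by move=> /leq_trans; apply.
  rewrite (bigD1 (Ordinal jr)) //= [X in (_ < X)%N](bigD1 (Ordinal jr)) //=.
  rewrite /e' eqxx -addSn leq_add //.
    by rewrite prednK // lt0n (e0 (Ordinal jr)).
  by apply: leq_sum => i /negbTE; rewrite -val_eqE /= => ->.
rewrite /e'; case: eqP => [->|_]; last by rewrite scalerA mulrC -scalerA eP // scaler0.
by rewrite scalerA -exprSr prednK ?eP // lt0n (e0 (Ordinal jr)).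
Qed.

Lemma gr_expx j k : @gr_comp S k (x j ^+ k).
Proof.
elim: k => [|k IH]; first exact: gr_one.
by rewrite exprS; exact: (gr_mul (x1 j) IH).
Qed.

Lemma torsion_comp (M : gradedModule S) (s : seq int) (f : int -> M) k j :
  uniq s -> (forall n, gm_comp n (f n)) -> x j ^+ k *: (\sum_(n <- s) f n) = 0 ->
  forall n, n \in s -> x j ^+ k *: f n = 0.
Proof.
move=> us Pf; rewrite scaler_sumr => fs n ns.
have [_ _ _ /(_ s (fun n => x j ^+ k *: f n) us)] := grading_shift k%:Z (gm_grading M).
by apply=> // m; rewrite addrC; apply: gm_scale => //; exact: gr_expx.
Qed.

Lemma fam_morph (M M' : gradedModule S) P P0 PB Px P' P0' PB' Px' (f : {linear M -> M'}) :
  (forall n v, P n v -> P' n (f v)) ->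
  morph 0 (f : @famC S x M P P0 PB Px -> @famC S x M' P' P0' PB' Px').
Proof.
move=> fP; split=> /=.
- by move=> u v; rewrite linearB.
- by move=> v; rewrite /leaf_dif linear0.
- by move=> j v; rewrite /mulx linearZ.
- by move=> p v; rewrite /leaf_pr; case: ifP => // _; rewrite linear0.
- by move=> n v Pv; rewrite addr0; exact: fP.
Qed.

Lemma opx_fam (M : gradedModule S) P P0 PB Px j e v :
  opx (@famC S x M P P0 PB Px) j e v = x j ^+ e *: v.
Proof.
rewrite opxE; elim: e => [|e /= ->]; first by rewrite scale1r.
by rewrite /mulx scalerA exprS.
Qed.

Variables (M : gradedModule S) (E : injective_resolution M).

Definition zcomp (i : nat) (n : int) : set (E i) :=
  [set z | gm_comp n z /\ res_d E i z = 0].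

Local Arguments zcomp i n _ : clear implicits.

Lemma zcomp0 i n : zcomp i n 0.
Proof. by split; [exact: mod_comp0 | rewrite linear0]. Qed.

Lemma zcompB i n u v : zcomp i n u -> zcomp i n v -> zcomp i n (u - v).
Proof.
by move=> [Pu du] [Pv dv]; split; [exact: mod_compB | rewrite linearB du dv subrr].
Qed.

Lemma zcompx i j n v : zcomp i n v -> zcomp i (n + 1) (x j *: v).
Proof.
by move=> [Pv dv]; split; [exact: mod_compx | rewrite linearZ /= dv scaler0].
Qed.

(** The [i]-th cosyzygy of [M], as the kernel of the differential. *)
Definition cosyz i : opcx S := famC (@zcomp0 i) (@zcompB i) (@zcompx i).

Lemma res_d_d i v : res_d E i.+1 (res_d E i v) = 0.
Proof. by apply/res_exact; exists v. Qed.

(** [w] is the component of degree [n] of [v]; the last clause says that it is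
    torsion if [v] is. *)
Lemma graded_lift (N N' : gradedModule S) (f : {linear N -> N'}) n v :
  is_graded f -> gm_comp n (f v) ->
  exists w, [/\ gm_comp n w, f w = f v &
    forall j k, x j ^+ k *: v = 0 -> x j ^+ k *: w = 0].
Proof.
move=> fG; have [s [g [us Pg ->]]] := grading_uniq v (gm_grading N).
rewrite linear_sum => /(grading_sum (gm_grading N') us (fun m => fG m _ (Pg m))) ->.
case: ifPn => ns; last first.
  exists 0; split; [exact: mod_comp0 | exact: linear0 |].
  by move=> *; rewrite scaler0.
by exists (g n); split=> // j k /torsion_comp ->.
Qed.

Lemma cosyz_ses i : @ses _ _ _ 0 (cosyz i) (modC x1 (E i)) (cosyz i.+1) id (res_d E i).
Proof.
split.
- by split=> // n v [dv _]; rewrite addr0.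
- apply: fam_morph => n v Pv; split; [exact: res_d_graded | exact: res_d_d].
- move=> n z [Pz /res_exact[y zy]]; rewrite {}zy in Pz *.
  by have [w [Pw wy _]] := graded_lift (res_d_graded (i := i)) Pz; exists w.
- by move=> n v; rewrite addr0 => Pv dv; exists v.
- by [].
- by move=> n v [].
Qed.

Lemma cosyz0 D (p n : int) : van r D (modC x1 M) p n <-> van r D (cosyz 0) p n.
Proof.
rewrite -{2}[n]addr0; apply: (@van_iso _ _ 0 (modC x1 M) (cosyz 0) (res_aug E)).
- apply: fam_morph => m v Pv; split; first exact: res_aug_graded.
  by apply/res_exact0; exists v.
- move=> m c; rewrite addr0 => -[Pc /res_exact0[y cy]]; rewrite {}cy in Pc *.
  by have [w [Pw wy _]] := graded_lift (@res_aug_graded _ _ E) Pc; exists w.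
- by move=> m q _ q0; apply: (@res_aug_inj _ _ E); rewrite q0 linear0.
Qed.

Variable c0 : int.
Hypothesis acyc : forall k q (m : int), c0 < m -> van r [set k] (modC x1 (regular S)) q m.

Lemma cosyz_shift i (p n : int) : 0 < p ->
  van r setT (cosyz i) (p + 1) n <-> van r setT (cosyz i.+1) p n.
Proof.
have vE q : 0 < q -> van r setT (modC x1 (E i)) q n.
  by move=> q0; apply: injective_van acyc _ q0; exact: res_injective.
move=> p0; have Z := cosyz_ses i; rewrite -{2}[n]addr0; split=> v.
  by apply: (van_quot Z) => //; rewrite addr0; exact: vE.
by apply: (van_sub Z) => //; rewrite addr0; apply: vE; lia.
Qed.

Lemma cosyz_shift_iter j i n :
  van r setT (cosyz i) j.+1%:Z n <-> van r setT (cosyz (i + j)) 1 n.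
Proof.
elim: j i => [|j IH] i; first by rewrite addn0.
have -> : j.+2%:Z = j.+1%:Z + 1 by lia.
by rewrite cosyz_shift // IH addSnnS.
Qed.

Lemma cosyz_lc0 n : van r setT (cosyz 0) 0 n <-> ~ lc_comp_neq0 E 0 n.
Proof.
have cc i : concentrated (cosyz i) by [].
split=> [v [z [Pz [/(torsionP _)[k xz] dz] z0]]|lc k _ c /(coc0P (cc _))[z [-> [Pz dz] xz]]].
  have [|k' [b [_ kk' [db pb] tb]]] := v k I (@cochain0 _ r k (cosyz 0) z).
    by apply/(coc0P (cc _)); exists z; split=> // j jr; rewrite opx_fam xz.
  apply: z0; move: tb; rewrite tau_cochain0 // (koszul_pr_neg (cc _) _ pb) // linear0.
  by rewrite -(cochain0_0 (cosyz 0) r k') => /cochain0_inj.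
suff -> : z = 0.
  by exists k, 0; rewrite cochain0_0 linear0 tau_id; split=> //; exact: bideg_0.
apply: contra_notP lc => z0; exists z; split=> //; split=> //.
by apply/(torsionP _); exists k => j jr; rewrite -opx_fam xz.
Qed.

Lemma cosyz_lc1 i n : van r setT (cosyz i) 1 n <-> ~ lc_comp_neq0 E i.+1 n.
Proof.
have cc l : concentrated (cosyz l) by [].
have ce : concentrated (modC x1 (E i)) by [].
have Z := cosyz_ses i; have hM := ses_h Z.
split=> [v [z [Pz [/(torsionP _)[k xz] dz] z0]]|lc].
  have [|k' [c [b [_ kk' /(coc0P ce)[y [-> Py xy]] [_ pb]]]]] :=
      van_hsurj Z (p := 0) v I (c' := @cochain0 _ r k (cosyz i.+1) z).
    by apply/(coc0P (cc _)); exists z; split=> // [|j jr];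
       [rewrite addr0 | rewrite opx_fam xz].
  rewrite (koszul_pr_neg (cc _) _ pb) // linear0 addr0 tau_cochain0 //.
  rewrite (kmap_cochain0 _ _ _ hM) => /cochain0_inj zy.
  apply: z0; exists y => //; apply/(torsionP _).
  by exists k' => j jr; rewrite -opx_fam xy.
have -> : (1 : int) = 0 + 1 by [].
apply: (hsurj_van Z); last first.
  by rewrite addr0; apply: injective_van acyc _ _; [exact: res_injective|].
move=> k _ c /(coc0P (cc _))[z [-> [Pz dz] xz]]; rewrite addr0 in Pz.
have [y /(torsionP _)[k' xy] zy] : exists2 y, torsion Splus y & z = res_d E i y.
  apply: contra_notP lc => nz; exists z; split=> //; split=> //.
  by apply/(torsionP _); exists k => j jr; rewrite -opx_fam xz.
rewrite zy in Pz; have [w [Pw wy xw]] := graded_lift (res_d_graded (i := i)) Pz.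
exists (maxn k k'), (@cochain0 _ r _ (modC x1 (E i)) w), 0; split=> //.
- exact: leq_maxl.
- apply/(coc0P ce); exists w; split=> // [|j jr]; first by rewrite addr0.
  by rewrite opx_fam -(subnK (leq_maxr k k')) exprD -scalerA (xw _ _ (xy j jr)) scaler0.
- exact: bideg_0.
rewrite linear0 addr0 tau_cochain0 ?leq_maxl // (kmap_cochain0 _ _ _ hM).
by rewrite wy zy.
Qed.

(** Dimension shifting along the sequences [0 -> Z_i -> E_i -> Z_(i+1) -> 0] of
    cosyzygies, whose middle terms have no Čech cohomology in positive degrees,
    reduces degree [i] to degree one of [Z_(i-1)]; there Čech cohomology is the
    cokernel of the map from the torsion of [E_(i-1)] to the torsion of [Z_i]. *)
Theorem lc_comp_van (i : nat) n :
  lc_comp_neq0 E i n <-> ~ van r setT (modC x1 M) i%:Z n.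
Proof.
rewrite cosyz0; case: i => [|i].
  by rewrite cosyz_lc0; split=> [h /(_ h)//|/contrapT].
by rewrite cosyz_shift_iter cosyz_lc1 add0n; split=> [h /(_ h)//|/contrapT].
Qed.

Lemma lc_neq0_comp i : lc_neq0 E i <-> exists n, lc_comp_neq0 E i n.
Proof.
split=> [[z [/(torsionP _)[k xz] dz] bz]|[n [z [_ cz bz]]]]; last by exists z.
have [s [f [us Pf zf]]] := grading_uniq z (gm_grading (E i)).
apply: contra_notP bz => nlc.
have bf n : n \in s -> @lc_boundaries _ _ E i (f n).
  move=> ns; apply: contra_notP nlc => nb; exists n, (f n); split=> //; split.
    apply/(torsionP _); exists k => j jr; apply: (torsion_comp us Pf) ns.
    by rewrite -zf xz.
  rewrite zf linear_sum in dz.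
  have [_ _ _ /(_ s (fun n => res_d E i (f n)) us)] := gm_grading (E i.+1).
  by apply=> // m; exact: res_d_graded.
rewrite zf; case: i {z xz dz zf} f Pf {nlc} bf => [|i] f Pf bf /=.
  by rewrite big_seq big1.
elim: s bf {us} => [|n s IH] bf.
  rewrite big_nil; exists 0; last by rewrite linear0.
  by exists 0%N => s _; rewrite scaler0.
have [|y /(torsionP _)[k1 xy] e1] := bf n; first exact: mem_head.
have [m ms|w /(torsionP _)[k2 xw] e] := IH.
  by apply: bf; rewrite inE ms orbT.
rewrite big_cons e1 [X in _ + X]e; exists (y + w); last by rewrite linearD.
apply/(torsionP _); exists (k1 + k2)%N => j jr.
by rewrite scalerDr exprD -!scalerA xw // scaler0 addr0 scalerA mulrC -scalerA xy ?scaler0.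
Qed.

End Comparison.

(** * Acyclicity of Koszul complexes in large internal degrees *)

Definition exact_above (B : nzRingType) (C : opcx B) (c0 : int) : Prop :=
  forall p n, c0 < n -> forall z, bideg C p n z -> dif C z = 0 ->
  exists2 b, bideg C (p - 1) n b & z = dif C b.

Lemma exact_aboveP (B : nzRingType) (C : opcx B) r k c0 :
  exact_above (koszul r k C) c0 <-> forall p n, c0 < n -> van r [set k] C p n.
Proof.
split=> [ex p n c0n|vC p n c0n z hz dz]; last exact: (van1P _ _ _ _ _).1 (vC p n c0n) _ _.
by apply/van1P => c [hc dc]; exact: ex.
Qed.

Section Raise.
Variables (B : nzRingType) (j : nat) (c0 : int).

(** Exactness of the cone of [x] means that [x] is bijective on cohomology above
    [c0]; then so are its powers. *)
Lemma exact_cone_pow (C : opcx B) e :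
  exact_above (cone j 1 C) c0 -> exact_above (cone j e C) c0.
Proof.
move=> ex1; elim: e => [|e IH] p n c0n [a b].
  move=> /cone_bideg[ha hb] [da /eqP]; rewrite subr_eq0 => /eqP/= ab.
  exists (b, 0); last by rewrite /= /cone_dif /= linear0 subr0 -ab.
  by apply/cone_bideg; split; [rewrite addr0 in hb | exact: bideg_0].
move=> /cone_bideg[ha hb] [/= da /eqP]; rewrite subr_eq0 => /eqP xab.
have [|||[u v] /cone_bideg[hu hv] [/= xau bE]] := IH p (n + 1) _ (op C j a, b).
- by lia.
- by apply/cone_bideg; split; [exact: bideg_op | rewrite -addrA; move: hb; congr bideg; lia].
- rewrite /= /cone_dif /= dif_op da linear0; congr (_, _).
  by rewrite -xab !opxE iterSr subrr.
have [||[u' v'] /cone_bideg[hu' hv'] [/= aE uE]] := ex1 p n c0n (a, u).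
- by apply/cone_bideg; split.
- by rewrite /= /cone_dif /= da xau subrr.
exists (u', opx C j e v' + v).
  apply/cone_bideg; split=> //; apply: bideg_D.
    have -> : n + e.+1%:Z = n + 1 + e%:Z by lia.
    exact: bideg_opx.
  by move: hv; congr bideg; lia.
rewrite /= /cone_dif /= -aE; congr (_, _).
rewrite bE uE linearB linearD /= opx_dif opprD addrA; congr (_ - _ - _).
by rewrite !opxE -iterSr.
Qed.

End Raise.

Definition opiso (B : nzRingType) (C C' : opcx B) : Prop :=
  exists (u : C -> C') (u' : C' -> C),
    [/\ morph 0 u, morph 0 u', cancel u u' & cancel u' u].

Lemma opiso_sym (B : nzRingType) (C C' : opcx B) : opiso C C' -> opiso C' C.
Proof. by move=> [u [u' [? ? ? ?]]]; exists u', u. Qed.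

Lemma opiso_trans (B : nzRingType) (C2 C1 C3 : opcx B) :
  opiso C1 C2 -> opiso C2 C3 -> opiso C1 C3.
Proof.
have comp (X Y Z : opcx B) (f : X -> Y) (g : Y -> Z) :
    morph 0 f -> morph 0 g -> morph 0 (g \o f).
  move=> fM gM; split=> /=.
  - by move=> a b; rewrite (morphB fM) (morphB gM).
  - by move=> a; rewrite (morph_dif fM) (morph_dif gM).
  - by move=> i a; rewrite (morph_op fM) (morph_op gM).
  - by move=> i a; rewrite (morph_pr fM) (morph_pr gM).
  - by move=> n a /(morph_deg fM)/(morph_deg gM); rewrite !addr0.
move=> [u [u' [uM uM' uK uK']]] [v [v' [vM vM' vK vK']]].
exists (v \o u), (u' \o v'); split; [exact: comp | exact: comp | |].
  exact: can_comp.
exact: can_comp.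
Qed.

Lemma opiso_cone (B : nzRingType) j e (C C' : opcx B) :
  opiso C C' -> opiso (cone j e C) (cone j e C').
Proof.
move=> [u [u' [uM uM' uK uK']]].
exists (@cone_map _ _ j e _ _ u), (@cone_map _ _ j e _ _ u').
split; [exact: cone_morph | exact: cone_morph | |].
  by move=> [a b]; rewrite /cone_map /= !uK.
by move=> [a b]; rewrite /cone_map /= !uK'.
Qed.

(** Exchanging two cones changes a sign on the component they share. *)
Lemma opiso_swap (B : nzRingType) j e i k (C : opcx B) :
  opiso (cone j e (cone i k C)) (cone i k (cone j e C)).
Proof.
pose s i' k' j' e' (c : cone j' e' (cone i' k' C)) : cone i' k' (cone j' e' C) :=
  ((c.1.1, c.2.1), (c.1.2, - c.2.2)).
have sM i' k' j' e' : morph 0 (@s i' k' j' e').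
  split.
  - by move=> [[a b] [c d]] [[a' b'] [c' d']]; rewrite /s /= opprD.
  - move=> [[a b] [c d]]; rewrite /s /= /cone_dif /= opx_cone.
    rewrite !opx_cone /=; congr (_, (_, _)) => /=.
    by rewrite linearN opprK !opprB opprD [RHS]addrCA [RHS]addrC addrAC.
  - move=> l [[a b] [c d]]; by congr (_, (_, _)); rewrite /= linearN.
  - move=> p [[a b] [c d]]; by congr (_, (_, _)); rewrite /= linearN.
  - move=> n [[a b] [c d]] [[/= da db] [/= dc dd]]; rewrite addr0.
    by do 2! split=> //=; rewrite addrAC; exact: deg_N.
exists (@s i k j e), (@s j e i k); split=> //.
  by move=> [[a b] [c d]]; rewrite /s /= opprK.
by move=> [[a b] [c d]]; rewrite /s /= opprK.
Qed.

Lemma opiso_koszul_cone (B : nzRingType) j e r k (C : opcx B) :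
  opiso (cone j e (koszul r k C)) (koszul r k (cone j e C)).
Proof.
elim: r => [|r IH] /=.
  exists id, id; split=> //; split=> // n c; by rewrite addr0.
exact: opiso_trans (opiso_swap _ _ _ _ _) (opiso_cone _ _ IH).
Qed.

Lemma exact_opiso (B : nzRingType) (C C' : opcx B) c0 :
  opiso C C' -> exact_above C c0 -> exact_above C' c0.
Proof.
move=> [u [u' [uM uM' uK uK']]] ex p n c0n z hz dz.
have [||b hb e] := ex p n c0n (u' z).
- by rewrite -[n]addr0; exact: (morph_bideg uM').
- by rewrite -(morph_dif uM') dz (morph0 uM').
exists (u b); first by rewrite -[n]addr0; exact: (morph_bideg uM).
by rewrite -(morph_dif uM) -e uK'.
Qed.

(** Exponents are raised one operator at a time. The operator to be treated is
    brought outermost, where [exact_cone_pow] applies, by letting the others act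
    on its cone; the bound never changes. *)
Lemma exact_koszul_pow (B : nzRingType) r k c0 (C : opcx B) :
  exact_above (koszul r 1 C) c0 -> exact_above (koszul r k C) c0.
Proof.
elim: r C => //= r IH C ex; apply: (@exact_cone_pow _ _ _ _ k).
apply: exact_opiso (opiso_sym (opiso_koszul_cone r 1 r k C)) _; apply: IH.
exact: exact_opiso (opiso_koszul_cone r 1 r 1 C) ex.
Qed.

Section NullHomotopy.
Variable B : nzRingType.

Definition null_homotopic (C : opcx B) (j : nat) : Prop :=
  exists s : C -> C, [/\ (forall u v, s (u - v) = s u - s v),
    (forall i v, s (op C i v) = op C i (s v)),
    (forall p n v, bideg C p n v -> bideg C (p - 1) (n + 1) (s v)) &
    forall v, dif C (s v) + s (dif C v) = op C j v].

(** The homotopy is the projection of the cone onto its second summand. *)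
Lemma null_homotopic_top (C : opcx B) j : null_homotopic (cone j 1 C) j.
Proof.
exists (fun c => (c.2, 0)); split.
- by move=> [a b] [c d]; congr (_, _); rewrite /= subr0.
- by move=> i [a b]; rewrite /= /cone_op /= linear0.
- by move=> p n [a b] /cone_bideg[_ hb]; apply/cone_bideg; split=> //; exact: bideg_0.
- by move=> [a b]; rewrite /= /cone_dif /= linear0 subr0; congr (_, _); rewrite /= ?addr0 // addrC subrK.
Qed.

Lemma null_homotopic_cone (C : opcx B) i j e :
  null_homotopic C j -> null_homotopic (cone i e C) j.
Proof.
move=> [s [sB sop sdeg sP]].
have s0 : s 0 = 0 by have := sB 0 0; rewrite !subrr.
have sN v : s (- v) = - s v by rewrite -sub0r sB s0 sub0r.
have sx l k v : s (opx C l k v) = opx C l k (s v).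
  by rewrite !opxE; elim: k => //= k IH; rewrite sop IH.
exists (fun c => (s c.1, - s c.2)); split.
- by move=> [a b] [c d] /=; rewrite !sB opprB; congr (_, _); rewrite /= opprK addrC.
- by move=> l [a b]; rewrite /= /cone_op /= !sop linearN.
- move=> p n [a b] /cone_bideg[ha hb]; apply/cone_bideg; split; first exact: sdeg.
  have -> : n + 1 + e%:Z = n + e%:Z + 1 by lia.
  by apply: bideg_N; exact: sdeg.
- move=> [a b]; rewrite /= /cone_dif /cone_op /=; congr (_, _); rewrite /= ?sP //.
  by rewrite linearN sB sx opprK opprB addrC addrA subrK addrC sP.
Qed.

Lemma koszul_null_homotopic (C : opcx B) r j :
  (j < r)%N -> null_homotopic (koszul r 1 C) j.
Proof.
elim: r => // r IH; rewrite ltnS leq_eqVlt => /predU1P[->|jr].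
  exact: null_homotopic_top.
exact/null_homotopic_cone/IH.
Qed.

(** [Z] ranges over both degrees at once, so that a single bound serves all
    cohomological degrees. *)
Definition graded_noetherian (r : nat) (C : opcx B) : Prop :=
  forall Z : int -> int -> set C,
  (forall p n z, Z p n z -> bideg C p n z) ->
  (forall p n, Z p n 0) ->
  (forall p n u v, Z p n u -> Z p n v -> Z p n (u - v)) ->
  (forall p n a v, Z p n v -> Z p n (a *: v)) ->
  (forall j p n v, (j < r)%N -> Z p n v -> Z p (n + 1) (op C j v)) ->
  exists c0, forall p n, c0 < n -> forall z, Z p n z ->
  exists2 y : nat -> C, (forall j, (j < r)%N -> Z p (n - 1) (y j)) &
    z = \sum_(j < r) op C j (y j).

(** The property passes to extensions: lift generators of the image of [Z] in the
    first summand, and correct by generators of its intersection with the second. *)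
Lemma graded_noetherian_cone (C : opcx B) r j e :
  graded_noetherian r C -> graded_noetherian r (cone j e C).
Proof.
move=> nC Z Zh Z0 ZB ZZ Zop.
have ZN p n v : Z p n v -> Z p n (- v) by move=> zv; rewrite -sub0r; exact: ZB.
pose Z1 p n : set C := [set a | exists b, Z p n (a, b)].
pose Z2 p n : set C := [set b | Z (p + 1) (n - e%:Z) (0, b)].
have [|||||c1 c1P] := nC Z1.
- by move=> p n a [b /Zh/cone_bideg[]].
- by move=> p n; exists 0; exact: Z0.
- by move=> p n u v [b zu] [c zv]; exists (b - c); exact: ZB zu zv.
- by move=> p n a v [b zv]; exists (a *: b); exact: ZZ zv.
- by move=> i p n v ir [b zv]; exists (op C i b); exact: Zop zv.
have [|||||c2 c2P] := nC Z2.
- move=> p n b /Zh/cone_bideg[_]; rewrite addrK.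
  by have -> : n - e%:Z + e%:Z = n by lia.
- by move=> p n; exact: Z0.
- move=> p n u v zu zv; have := ZB _ _ _ _ zu zv.
  by rewrite /Z2 /=; congr (Z _ _ (_, _)); rewrite subr0.
- move=> p n a v zv; have := ZZ _ _ a _ zv.
  by rewrite /Z2 /=; congr (Z _ _ (_, _)); rewrite scaler0.
- move=> i p n v ir zv; have := Zop _ _ _ _ ir zv.
  rewrite /Z2 /= /cone_op /= linear0; have -> : n + 1 - e%:Z = n - e%:Z + 1 by lia.
  by [].
exists (Num.max c1 c2) => p n; rewrite gt_max => /andP[c1n c2n] [a b] zab.
have [|y zy ae] := c1P p n c1n a; first by exists b.
have /choice[w wP] : forall j, exists w, (j < r)%N -> Z p (n - 1) (y j, w).
  move=> i; have [ir|] := boolP (i < r)%N; last by exists 0.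
  by have [w zw] := zy i ir; exists w.
have sum_pair (f g : nat -> C) : \sum_(i < r) op (cone j e C) i (f i, g i) =
    (\sum_(i < r) op C i (f i), \sum_(i < r) op C i (g i)).
  by rewrite [LHS]surjective_pairing !raddf_sum.
have Zsum p' n' (f : 'I_r -> cone j e C) : (forall i, Z p' n' (f i)) -> Z p' n' (\sum_i f i).
  move=> Zf; elim/big_ind: _ => // u v zu zv.
  by rewrite -[v]opprK; apply: ZB => //; exact: ZN.
have [||v zv be] := c2P (p - 1) (n + e%:Z) _ (b - \sum_(i < r) op C i (w i)).
- by lia.
- rewrite /Z2 /= subrK addrK.
  have := ZB _ _ _ _ zab (Zsum p n (fun i : 'I_r => op (cone j e C) i (y i, w i)) _).
  rewrite sum_pair -ae => /(_ _) H.
  have {}H : Z p n ((a, b) - (a, \sum_(i < r) op C i (w i))).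
    apply: H => i; have := Zop i p (n - 1) _ (ltn_ord i) (wP i (ltn_ord i)).
    by rewrite subrK.
  by move: H; congr (Z _ _ (_, _)); rewrite subrr.
exists (fun i => (y i, w i + v i)).
  move=> i ir; rewrite -[(_, _)]/((y i, w i + v i) : cone j e C).
  have := zv i ir; rewrite /Z2 /= subrK => zvi.
  have {}zvi : Z p (n - 1) (0, v i).
    by move: zvi; congr (Z _ _ _); lia.
  have := ZB _ _ _ _ (wP i ir) (ZN _ _ _ zvi).
  by congr (Z _ _ (_, _)); rewrite /= opprK ?addr0.
rewrite (sum_pair y (fun i => w i + v i)) -ae; congr (_, _).
under eq_bigr do rewrite linearD /=.
by rewrite big_split /= -be addrC subrK.
Qed.

Lemma graded_noetherian_koszul (C : opcx B) r s k :
  graded_noetherian r C -> graded_noetherian r (koszul s k C).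
Proof. by move=> nC; elim: s => //= s; exact: graded_noetherian_cone. Qed.

Lemma koszul_deg_scale (C : opcx B) r k :
  (forall n a v, deg C n v -> deg C n (a *: v)) ->
  forall n a v, deg (koszul r k C) n v -> deg (koszul r k C) n (a *: v).
Proof. by move=> dZ; elim: r => //= r IH n a [u v] [du dv]; split; exact: IH. Qed.

(** A cocycle of large internal degree is a combination of products of cocycles
    with the operators, and these products are boundaries because the operators
    are null-homotopic. *)
Lemma koszul_exact_above (C : opcx B) r :
  (forall n a v, deg C n v -> deg C n (a *: v)) -> graded_noetherian r C ->
  exists c0, exact_above (koszul r 1 C) c0.
Proof.
move=> dZ /(@graded_noetherian_koszul C r r 1) nK.
pose Z p n : set (koszul r 1 C) := [set z | bideg _ p n z /\ dif _ z = 0].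
have [|||||c0 c0P] := nK Z.
- by move=> p n z [].
- by move=> p n; split; [exact: bideg_0 | exact: linear0].
- move=> p n u v [hu du] [hv dv]; split; first exact: bideg_B.
  by rewrite linearB /= du dv subrr.
- move=> p n a v [[hv pv] dv]; split; last by rewrite linearZ /= dv scaler0.
  by split; [exact: koszul_deg_scale | rewrite linearZ /= pv].
- move=> j p n v _ [hv dv]; split; first exact: bideg_op.
  by rewrite dif_op dv linear0.
exists c0 => p n c0n z hz dz; have [y zy ->] := c0P p n c0n z (conj hz dz).
have /choice[b bP] : forall j : 'I_r, exists b, bideg (koszul r 1 C) (p - 1) n b /\
    op (koszul r 1 C) j (y j) = dif _ b.
  move=> j; have [s [sB _ sdeg sP]] := koszul_null_homotopic C (ltn_ord j).
  have [hy dy] := zy j (ltn_ord j); exists (s (y j)); split.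
    by have := sdeg _ _ _ hy; rewrite subrK.
  have s0 : s 0 = 0 by have := sB 0 0; rewrite !subrr.
  by rewrite -sP dy s0 addr0.
exists (\sum_j b j).
  elim/big_ind: _ => [|u v|j _]; [exact: bideg_0 | exact: bideg_D | exact: (bP j).1].
by rewrite linear_sum; apply: eq_bigr => j _; exact: (bP j).2.
Qed.

End NullHomotopy.

(** * Graded ideals over a Noetherian ring *)

Section GradedIdeals.
Variables (A : comNzRingType) (F : nat -> set A) (a : nat -> A) (r n0 : nat).
Hypothesis noethA : noetherian A.
Hypothesis F_ideal : forall n, is_ideal (F n).
Hypothesis F_mul : forall j n x, F n x -> F n.+1 (a j * x).
Hypothesis F_gen : forall n x, (n0 <= n)%N -> F n.+1 x ->
  exists2 y : nat -> A, (forall j, F n (y j)) & x = \sum_(j < r) a j * y j.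

Lemma idealD (I : set A) x y : is_ideal I -> I x -> I y -> I (x + y).
Proof. by move=> [I0 IM] Ix Iy; rewrite -[x]mul1r; exact: IM. Qed.

Lemma idealM (I : set A) x y : is_ideal I -> I y -> I (x * y).
Proof. by move=> [I0 IM] Iy; rewrite -[x * y]addr0; exact: IM. Qed.

Lemma ideal_sum (I : set A) m (f : 'I_m -> A) : is_ideal I ->
  (forall i, I (f i)) -> I (\sum_i f i).
Proof.
move=> iI If; elim/big_ind: _ => [|x y|i _]; first by case: iI.
  exact: idealD.
exact: If.
Qed.

(** Mutual inclusion beyond [l0], rather than equality with [L l0], lets [l0] be
    increased. *)
Definition stable (T : Type) (L : nat -> set T) : Prop :=
  exists l0, forall l l', (l0 <= l)%N -> (l0 <= l')%N -> L l `<=` L l'.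

Lemma stable_fin (T : Type) (L : nat -> nat -> set T) m :
  (forall k, (k < m)%N -> stable (L k)) ->
  exists l0, forall k, (k < m)%N -> forall l l', (l0 <= l)%N -> (l0 <= l')%N ->
    L k l `<=` L k l'.
Proof.
elim: m => [|m IH] sL; first by exists 0%N.
have [k km|l0 l0P] := IH; first exact/sL/ltnW.
have [l1 l1P] := sL m (ltnSn m); exists (maxn l0 l1) => k.
rewrite ltnS leq_eqVlt => /predU1P[->|km] l l'; rewrite !geq_max.
  by move=> /andP[_ h] /andP[_ h']; exact: l1P.
by move=> /andP[h _] /andP[h' _]; exact: l0P.
Qed.

Lemma chain_le (T : Type) (L : nat -> set T) l l' :
  (forall l, L l `<=` L l.+1) -> (l <= l')%N -> L l `<=` L l'.
Proof.
move=> LS /subnK <-; elim: (l' - l)%N => //= d IH; exact: subset_trans IH (LS _).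
Qed.

Lemma ideal_chain_stable (L : nat -> set A) :
  (forall l, is_ideal (L l)) -> (forall l, L l `<=` L l.+1) -> stable L.
Proof.
move=> Li LS; have Lle := chain_le LS.
have [|s sE] := noethA (I := \bigcup_l L l).
  split; first by exists 0%N => //; case: (Li 0%N).
  move=> c u v [l _ lu] [l' _ lv]; exists (maxn l l') => //.
  by apply: (Li _).2; [exact: Lle (leq_maxl _ _) _ lu | exact: Lle (leq_maxr _ _) _ lv].
have [l0 l0P] : exists l0, forall g, g \in s -> L l0 g.
  have : forall g, g \in s -> exists l, L l g.
    move=> g gs; have : (\bigcup_l L l) g.
      rewrite sE; exists 1%N, (fun=> 1), (fun=> g); split=> //.
      by rewrite big_ord1 mul1r.
    by case=> l _; exists l.
  elim: s {sE} => [|g s IH] sL; first by exists 0%N.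
  have [h hs|l lP] := IH; first by apply: sL; rewrite inE hs orbT.
  have [l' l'P] := sL g (mem_head _ _); exists (maxn l l') => h.
  rewrite inE => /predU1P[->|hs]; first exact: Lle (leq_maxr _ _) _ l'P.
  exact: Lle (leq_maxl _ _) _ (lP h hs).
exists l0 => l l' _ ll' x Lx; apply: (Lle l0) => //.
have : (\bigcup_l L l) x by exists l.
rewrite sE => -[m [c [g [gs ->]]]]; apply: ideal_sum => // i.
by apply: idealM => //; exact/l0P/gs.
Qed.

Definition gideal (N : nat -> set A) : Prop :=
  [/\ forall n, N n `<=` F n, forall n, is_ideal (N n) &
      forall j n x, (j < r)%N -> N n x -> N n.+1 (a j * x)].

(** A graded ideal as a single set, so that [stable] is uniform in the degree. *)
Definition total (N : nat -> set A) : set (nat * A) := [set u | N u.1 u.2].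

Lemma expF j k n x : F n x -> F (n + k)%N (a j ^+ k * x).
Proof.
move=> Fx; elim: k => [|k IH]; first by rewrite addn0 mul1r.
by rewrite addnS exprS -mulrA; exact: F_mul.
Qed.

Section Colon.
Variables (s : nat) (N : nat -> set A).
Hypotheses (sr : (s < r)%N) (gN : gideal N).

Definition mul_a n : set A :=
  if n is n'.+1 then [set v | exists2 w, F n' w & v = a s * w] else [set 0].

(** [(N : a_s ^ k) + a_s F]. Modulo [a_s F] these ideals play the part of the
    ideals of leading coefficients in Hilbert's basis theorem. *)
Definition colon k n : set A := [set y | exists u v,
  [/\ y = u + v, F n u, N (n + k)%N (a s ^+ k * u) & mul_a n v]].

Lemma mul_a0 n : mul_a n 0.
Proof. by case: n => //= n; exists 0; [case: (F_ideal n) | rewrite mulr0]. Qed.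

Lemma colon_mul_a k n v : mul_a n v -> colon k n v.
Proof.
move=> av; exists 0, v; split=> //; first by rewrite add0r.
  by case: (F_ideal n).
by rewrite mulr0; have [_ /(_ (n + k)%N)[]] := gN.
Qed.

Lemma mul_aF n v : mul_a n v -> F n v.
Proof.
by case: n => [->|n [w Fw ->]]; [case: (F_ideal 0) | exact: F_mul].
Qed.

Lemma colon_gideal k : gideal (colon k).
Proof.
have [NF Ni Na] := gN; split.
- move=> n _ [u [v [-> Fu _ /mul_aF]]]; exact: idealD.
- move=> n; split; first exact/colon_mul_a/mul_a0.
  move=> c _ _ [u [v [-> Fu Nu av]]] [u' [v' [-> Fu' Nu' av']]].
  exists (c * u + u'), (c * v + v'); split.
  + by ring.
  + exact: (F_ideal n).2.
  + have -> : a s ^+ k * (c * u + u') = c * (a s ^+ k * u) + a s ^+ k * u' by ring.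
    exact: (Ni _).2.
  + case: n av av' {Fu Nu Fu' Nu'} => [-> ->|n [w Fw ->] [w' Fw' ->]].
      by rewrite /mul_a /= mulr0 addr0.
    by exists (c * w + w'); [exact: (F_ideal n).2 | ring].
- move=> j n _ jr [u [v [-> Fu Nu av]]]; exists (a j * u), (a j * v); split.
  + by ring.
  + exact: F_mul.
  + have -> : a s ^+ k * (a j * u) = a j * (a s ^+ k * u) by ring.
    exact: Na.
  + exists (match n with 0 => 0 | n'.+1 => a j * xget 0 [set w | F n' w /\ v = a s * w] end).
      case: n av {Fu Nu} => [_|n [w Fw ->]]; first by case: (F_ideal 0).
      by apply: F_mul; case: xgetP => [y _ [] //|_]; case: (F_ideal n).
    case: n av {Fu Nu} => [->|n [w Fw vE]]; first by rewrite !mulr0.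
    case: xgetP => [y _ [_ ->]|/(_ w)]; [by ring | by case].
Qed.

Lemma colonS k n : colon k n `<=` colon k.+1 n.
Proof.
move=> _ [u [v [-> Fu Nu av]]]; exists u, v; split=> //.
by rewrite addnS exprS -mulrA; have [_ _] := gN; exact.
Qed.

End Colon.

Lemma colon_sub s (N N' : nat -> set A) k n : (forall n, N n `<=` N' n) ->
  colon s N k n `<=` colon s N' k n.
Proof. by move=> NN _ [u [v [-> Fu Nu av]]]; exists u, v; split=> //; exact: NN. Qed.

(** Approximating an element of [(N : a_s ^ k)] by one of [(N' : a_s ^ k)] leaves
    [a_s] times an element of [(N : a_s ^ (k + 1))] of smaller degree, so the
    approximation ends after finitely many steps. *)
Lemma colon_eq s (N N' : nat -> set A) : (s < r)%N -> gideal N -> gideal N' ->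
  (forall n, N' n `<=` N n) ->
  (forall k n, colon s N k n `<=` colon s N' k n) -> forall n, N n `<=` N' n.
Proof.
move=> sr [NF Ni Na] [NF' Ni' Na'] N'N cNN'.
suff key n : forall k x, F n x -> N (n + k)%N (a s ^+ k * x) -> N' (n + k)%N (a s ^+ k * x).
  by move=> n x Nx; have := key n 0%N x (NF _ _ Nx); rewrite addn0 mul1r; exact.
elim: n => [|n IH] k x Fx Nx.
  have [|u [v [xE Fu Nu av]]] := cNN' k 0%N x; first by exists x, 0; split=> //; rewrite addr0.
  by rewrite xE (av : v = 0) addr0.
have [|u [v [xE Fu Nu [w Fw vE]]]] := cNN' k n.+1 x.
  by exists x, 0; split=> //; [rewrite addr0 | exact: mul_a0].
have xw : a s ^+ k * x - a s ^+ k * u = a s ^+ k.+1 * w by rewrite xE vE exprS; ring.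
have -> : a s ^+ k * x = a s ^+ k.+1 * w + a s ^+ k * u by rewrite -xw subrK.
apply: idealD => //; rewrite addSnnS; apply: IH => //; rewrite -addSnnS -xw.
by rewrite addrC -mulN1r; apply: (Ni _).2 => //; exact: N'N.
Qed.

(** Hilbert's basis theorem for graded ideals: the chains considered contain the
    multiples of all but the first [s] of the [a j], and the induction on [s]
    compares ideals through [colon_eq]. For [s = 0] only the degrees up to [n0]
    matter. *)
Lemma gideal_chain_stable s (L : nat -> nat -> set A) : (s <= r)%N ->
  (forall l, gideal (L l)) -> (forall l n, L l n `<=` L l.+1 n) ->
  (forall l j n x, (s <= j < r)%N -> F n x -> L l n.+1 (a j * x)) ->
  stable (fun l => total (L l)).
Proof.
elim: s L => [|s IH] L sr gL LS La.
  have [k _|l0 l0P] := @stable_fin A (fun n l => L l n) n0.+1.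
    by apply: ideal_chain_stable => // l; have [_ ] := gL l.
  exists l0 => l l' ll ll' [n x]; rewrite /total /= => Lx.
  have [nn0|n0n] := ltnP n n0.+1; first exact: l0P ll ll' _ Lx.
  case: n n0n Lx => // n n0n Lx; have [LF Li _] := gL l; have [_ Li' _] := gL l'.
  have [y Fy ->] := F_gen n0n (LF _ _ Lx).
  by apply: ideal_sum => // j; apply: La => //=.
have Lle n l l' := @chain_le _ (fun l => L l n) l l' (fun l => LS l n).
have ca l k j n x : (s <= j < r)%N -> F n x -> colon s (L l) k n.+1 (a j * x).
  move=> /andP[sj jr] Fx; move: sj; rewrite leq_eqVlt => /predU1P[<-|sj].
    by apply: colon_mul_a => //; exists x.
  exists (a j * x), 0; split; [by rewrite addr0 | exact: F_mul | | exact: mul_a0].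
  have -> : a s ^+ k * (a j * x) = a j * (a s ^+ k * x) by ring.
  by rewrite addSn; apply: La; [rewrite sj | exact: expF].
have cle l l' k k' n : (l <= l')%N -> (k <= k')%N ->
    colon s (L l) k n `<=` colon s (L l') k' n.
  move=> ll' kk'; apply: (@subset_trans _ (colon s (L l') k n)).
    by apply: colon_sub => m; exact: Lle.
  by apply: (@chain_le _ (fun k => colon s (L l') k n)) => // m; exact: colonS.
(* Stabilizing the diagonal colons takes care of all exponents k >= d0 at once,
   and leaves finitely many chains, one for each k < d0. *)
have [|||d0 d0P] := IH (fun l => colon s (L l) l) (ltnW sr).
- by move=> l; exact: colon_gideal.
- by move=> l n; exact: cle.
- by move=> l j n x jr Fx; exact: ca.
have [k _|l0 l0P] := @stable_fin _ (fun k l => total (colon s (L l) k)) d0.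
  apply: (IH (fun l => colon s (L l) k)) (ltnW sr) _ _ _.
  - by move=> l; exact: colon_gideal.
  - by move=> l n; exact: cle.
  - by move=> l j n x jr Fx; exact: ca.
exists (maxn l0 d0) => l l'; rewrite !geq_max => /andP[l0l d0l] /andP[l0l' d0l'].
have [l'l|/ltnW ll'] := leqP l l'; first by move=> [n x]; exact: Lle.
move=> [n x]; apply: (colon_eq sr (gL l) (gL l')) => [m|k m y yc]; first exact: Lle.
have [kd|dk] := ltnP k d0; first exact: (l0P k kd l l' l0l l0l' (m, y) yc).
pose d := maxn l k.
have yd : total (colon s (L d) d) (m, y).
  by apply: cle yc; [exact: leq_maxl | exact: leq_maxr].
have := d0P d d0 (leq_trans d0l (leq_maxl _ _)) (leqnn _) (m, y) yd.
exact: cle.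
Qed.

Variable Z : nat -> set A.
Hypothesis gZ : gideal Z.

(** The graded ideal generated by the part of [Z] of degree at most [l]. *)
Fixpoint trunc_gen (l n : nat) : set A :=
  match n with
  | 0 => Z 0%N
  | n'.+1 => if (n <= l)%N then Z n else
      [set x | exists2 y : nat -> A, (forall j, trunc_gen l n' (y j)) &
        x = \sum_(j < r) a j * y j]
  end.

Lemma trunc_gen_sub l n : trunc_gen l n `<=` Z n.
Proof.
have [_ Zi Za] := gZ; elim: n => //= n IH; case: ifP => [_ ? //|_ x [y yP ->]].
by apply: ideal_sum => // j; apply: Za => //; exact: IH.
Qed.

Lemma trunc_gen_gideal l : gideal (trunc_gen l).
Proof.
have [ZF Zi Za] := gZ.
have ti n : is_ideal (trunc_gen l n).
  elim: n => [|n [IH0 IHM]]; first exact: Zi.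
  rewrite /=; case: ifP => _; first exact: Zi.
  split; first by exists (fun=> 0) => // ; rewrite big1 // => j _; rewrite mulr0.
  move=> c _ _ [y yP ->] [y' yP' ->]; exists (fun j => c * y j + y' j).
    by move=> j; exact: IHM.
  by rewrite mulr_sumr -big_split; apply: eq_bigr => j _ /=; ring.
split; [by move=> n x tx; exact/ZF/trunc_gen_sub/tx | exact: ti |].
move=> j n x jr tx.
rewrite /=; case: ifP => nl; first by apply: Za => //; exact: trunc_gen_sub tx.
exists (fun i => if i == j then x else 0).
  by move=> i; case: eqP => // _; case: (ti n).
rewrite (bigD1 (Ordinal jr)) //= eqxx big1 ?addr0 // => i /negbTE.
by rewrite -val_eqE /= => ->; rewrite mulr0.
Qed.

Lemma trunc_genS l n : trunc_gen l n `<=` trunc_gen l.+1 n.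
Proof.
elim: n => //= n IH; case: ifP => [nl|_]; first by rewrite ltnS ltnW.
case: ifP => nl; last by move=> _ [y yP ->]; exists y => // j; exact: IH.
move=> _ [y yP ->]; have [_ Zi Za] := gZ; apply: ideal_sum => // j.
by apply: Za => //; exact: trunc_gen_sub (yP j).
Qed.

(** The truncations of [Z] form a stationary chain. *)
Lemma gideal_eventually : exists m, forall n, (m <= n)%N -> forall x, Z n.+1 x ->
  exists2 y : nat -> A, (forall j, Z n (y j)) & x = \sum_(j < r) a j * y j.
Proof.
have [|||m mP] := @gideal_chain_stable r trunc_gen (leqnn r).
- exact: trunc_gen_gideal.
- exact: trunc_genS.
- by move=> l j n x /andP[rj /(leq_ltn_trans rj)]; rewrite ltnn.
exists m => n mn x Zx; have := mP n.+1 m (leqW mn) (leqnn m) (n.+1, x).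
rewrite /total /= leqnn ltnNge mn /= => /(_ Zx)[y yP ->].
by exists y => // j; exact: trunc_gen_sub (yP j).
Qed.

End GradedIdeals.

(** * The Rees algebra and the associated graded ring *)

Lemma good_generators (A : comNzRingType) (F : filtration A) :
  noetherian A -> good_filtration F ->
  exists (r n0 : nat) (a : nat -> A), (forall j, F 1%N (a j)) /\
  forall n x, (n0 <= n)%N -> F n.+1 x ->
  exists2 y : nat -> A, (forall j, F n (y j)) & x = \sum_(j < r) a j * y j.
Proof.
move=> noethA [I [Iid IF [n0 n0P]]]; have [s sE] := noethA I Iid.
have I1 : I `<=` F 1%N.
  move=> u Iu; apply: (IF 0%N); exists 1%N, (fun=> 1), (fun=> u); split.
    by move=> _; exists u, 1; rewrite mulr1; split=> //; rewrite fil_0.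
  by rewrite big_ord1 mul1r.
exists (size s), n0, (nth 0 s); split.
  move=> j; have [js|sj] := ltnP j (size s); last first.
    by rewrite nth_default //; case: (fil_ideal F 1).
  apply: I1; rewrite sE; exists 1%N, (fun=> 1), (fun=> nth 0 s j); split.
    by move=> _; exact: mem_nth.
  by rewrite big_ord1 mul1r.
move=> n x nn; rewrite n0P //.
pose W := [set x | exists2 y : nat -> A, (forall j, F n (y j)) &
  x = \sum_(j < size s) nth 0 s j * y j].
have Wi : is_ideal W.
  split; first by exists (fun=> 0); [by move=> j; case: (fil_ideal F n) |
    rewrite big1 // => j _; rewrite mulr0].
  move=> c _ _ [y yP ->] [z zP ->]; exists (fun j => c * y j + z j).
    by move=> j; exact: (fil_ideal F n).2.
  by rewrite mulr_sumr -big_split; apply: eq_bigr => j _ /=; ring.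
move=> [m [c [g [gP ->]]]]; apply: (ideal_sum Wi) => i; apply: (idealM _ Wi).
have [u [v [Iu Fv ->]]] := gP i; move: Iu; rewrite sE => -[m' [d [h [hs ->]]]].
rewrite mulr_suml; apply: (ideal_sum Wi) => k.
exists (fun j => if j == index (h k) s then d k * v else 0).
  by move=> j; case: eqP => _; [exact: fil_mulr | case: (fil_ideal F n)].
have hk : (index (h k) s < size s)%N by rewrite index_mem; exact: hs.
rewrite (bigD1 (Ordinal hk)) //= eqxx big1 ?addr0 => [|j /negbTE].
  by rewrite nth_index; [ring | exact: hs].
by rewrite -val_eqE /= => ->; rewrite mulr0.
Qed.

Section FamiliesInA.
Variables (A : comNzRingType) (a : nat -> A).

Definition mulA (j : nat) (v : A^o) : A^o := a j * v.

Lemma mulA_linear j : linear (mulA j).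
Proof. by move=> c u v; rewrite /mulA /GRing.scale /=; ring. Qed.

HB.instance Definition _ j := GRing.isLinear.Build A A^o A^o *:%R (mulA j) (mulA_linear j).

Lemma mulA_comm i j v : mulA i (mulA j v) = mulA j (mulA i v).
Proof. by rewrite /mulA; ring. Qed.

Section Family.
Variable G : nat -> set A.
Hypothesis G_ideal : forall n, is_ideal (G n).
Hypothesis G_mul : forall j n x, G n x -> G n.+1 (a j * x).

Definition ext_comp (n : int) : set A^o := if n is Posz m then G m else [set 0].

Lemma ext_comp0 n : ext_comp n 0.
Proof. by case: n => // n; case: (G_ideal n). Qed.

Lemma ext_compZ n c u : ext_comp n u -> ext_comp n (c *: u).
Proof.
case: n => [n|n]; first by move=> Gu; exact: (idealM _ (G_ideal n) Gu).
by rewrite /ext_comp /= => ->; rewrite scaler0.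
Qed.

Lemma ext_compB n u v : ext_comp n u -> ext_comp n v -> ext_comp n (u - v).
Proof.
case: n => [n|n] Gu Gv; last by rewrite (Gu : u = 0) (Gv : v = 0) subrr; exact: ext_comp0.
have Gn : G n (- v) by rewrite -mulN1r; exact: (idealM _ (G_ideal n) Gv).
exact: (idealD (G_ideal n) Gu Gn).
Qed.

Lemma ext_compx j n v : ext_comp n v -> ext_comp (n + 1) (mulA j v).
Proof.
case: n => [n|n] Gv; first by rewrite addrC; exact: G_mul.
by rewrite (Gv : v = 0) /mulA mulr0; exact: ext_comp0.
Qed.

(** The graded module [G 0 + G 1 t + ...] with [t] set to [1]. *)
Definition extC : opcx A := leaf mulA_comm ext_comp0 ext_compB ext_compx.

End Family.

Lemma extC_noetherian (F : nat -> set A) r n0 Fi Fm : noetherian A ->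
  (forall n x, (n0 <= n)%N -> F n.+1 x ->
    exists2 y : nat -> A, (forall j, F n (y j)) & x = \sum_(j < r) a j * y j) ->
  graded_noetherian r (@extC F Fi Fm).
Proof.
move=> noethA Fgen Z Zh Z0 ZB ZZ Zop.
have ZD p n u v : Z p n u -> Z p n v -> Z p n (u + v).
  move=> zu zv; rewrite -[v]opprK; apply: (ZB) => //.
  by rewrite -[- v]sub0r; exact: ZB.
have [|m mP] := @gideal_eventually A F a r n0 noethA Fi Fm Fgen (fun n => Z 0 n%:Z).
  split.
  - by move=> n x /Zh[].
  - by move=> n; split=> // c u v zu zv; apply: ZD => //; exact: ZZ.
  - move=> j n x jr zx; have := Zop j 0 n x jr zx.
    by rewrite addrC.
exists m%:Z => p n mn z Zz; have [p0|p0] := eqVneq p 0; last first.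
  have [_ /=] := Zh _ _ _ Zz; rewrite /leaf_pr (negbTE p0) => <-.
  exists (fun=> 0) => //; rewrite big1 // => j _.
  by rewrite linear0.
move: Zz mn; rewrite p0; case: n => [[|n]|n] Zz mn; [by lia| |by lia].
have [|y yP ->] := mP n _ z Zz; first by lia.
exists y => // j _; have -> : n.+1%:Z - 1 = n%:Z by lia.
exact: yP.
Qed.

Lemma extC_acyclic (F : nat -> set A) r n0 Fi Fm : noetherian A ->
  (forall n x, (n0 <= n)%N -> F n.+1 x ->
    exists2 y : nat -> A, (forall j, F n (y j)) & x = \sum_(j < r) a j * y j) ->
  exists c0 : int, forall k p (n : int), c0 < n -> van r [set k] (@extC F Fi Fm) p n.
Proof.
move=> noethA Fgen; have nF := @extC_noetherian F r n0 Fi Fm noethA Fgen.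
have [n c v|c0 ex1] := koszul_exact_above _ nF; first exact: ext_compZ.
by exists c0 => k; apply/exact_aboveP; exact: exact_koszul_pow.
Qed.

End FamiliesInA.

Section Rees.
Variables (A : comNzRingType) (F : filtration A) (r n0 : nat) (a : nat -> A).
Hypothesis a1 : forall j, F 1%N (a j).
Hypothesis Fgen : forall n x, (n0 <= n)%N -> F n.+1 x ->
  exists2 y : nat -> A, (forall j, F n (y j)) & x = \sum_(j < r) a j * y j.

Local Notation RR := (rees_algebra F).
Local Notation GG := (assoc_graded_ring F).

Definition xR (j : nat) : RR := Rees (rees_mono_subproof (a1 j)).

Lemma xR1 j : @gr_comp RR 1%N (xR j).
Proof. by exists (a j). Qed.

Definition xG (j : nat) : GG := assoc_pi (xR j).

Lemma xG1 j : @gr_comp GG 1%N (xG j).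
Proof. by exists (xR j) => //; exact: xR1. Qed.

Local Notation RC := (modC xR1 (regular RR)).
Local Notation GC := (modC xG1 (regular GG)).

Lemma a_mul j n x : F n x -> F n.+1 (a j * x).
Proof. by move=> Fx; exact: (fil_prod (a1 j) Fx). Qed.

Definition fil_plus (n : nat) : set A := if n is 0 then [set 0] else F n.

Lemma fil_plus_ideal n : is_ideal (fil_plus n).
Proof.
case: n => [|n]; last exact: fil_ideal.
by split=> // c u v -> ->; rewrite mulr0 addr0.
Qed.

Lemma fil_plus_mul j n x : fil_plus n x -> fil_plus n.+1 (a j * x).
Proof.
by case: n => [|n] /=; [move=> ->; rewrite mulr0; case: (fil_ideal F 1) | exact: a_mul].
Qed.

Local Notation AC := (extC (fil_ideal F) a_mul).
Local Notation ACplus := (extC fil_plus_ideal fil_plus_mul).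

(** The components of [R_+ = I_1 t + I_2 t^2 + ...]. *)
Definition plus_comp (n : int) : set (regular RR) :=
  [set p : regular RR | gm_comp n p /\ (rees_val (p : rees F))`_0 = 0].

Lemma plus_comp0 n : plus_comp n 0.
Proof. by split; [exact: mod_comp0 | exact: coef0]. Qed.

Lemma plus_compB n u v : plus_comp n u -> plus_comp n v -> plus_comp n (u - v).
Proof.
move=> [Pu u0] [Pv v0]; split; first exact: mod_compB.
by rewrite coefB u0 v0 subrr.
Qed.

Lemma plus_compx j n v : plus_comp n v -> plus_comp (n + 1) (xR j *: v).
Proof.
move=> [Pv v0]; split; first by apply: mod_compx => //; exact: xR1.
by rewrite coef0M v0 mulr0.
Qed.

Definition plusC : opcx RR := famC plus_comp0 plus_compB plus_compx.

(** The kernel [I_1 + I_2 t + ...] of [R -> G]; it is [R_+] with its degrees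
    lowered by one. *)
Definition ker_comp (n : int) : set (regular RR) :=
  [set p : regular RR | gm_comp n p /\ assoc_pi (p : rees F) = 0].

Lemma ker_comp0 n : ker_comp n 0.
Proof. by split; [exact: mod_comp0 | rewrite /assoc_pi rmorph0]. Qed.

Lemma ker_compB n u v : ker_comp n u -> ker_comp n v -> ker_comp n (u - v).
Proof.
move=> [Pu u0] [Pv v0]; split; first exact: mod_compB.
by rewrite assoc_piB u0 v0 subrr.
Qed.

Lemma ker_compx j n v : ker_comp n v -> ker_comp (n + 1) (xR j *: v).
Proof.
move=> [Pv v0]; split; first by apply: mod_compx => //; exact: xR1.
by rewrite assoc_piM v0 mulr0.
Qed.

Definition kerC : opcx RR := famC ker_comp0 ker_compB ker_compx.

(** Setting [t] to [1] is injective on homogeneous elements. It makes the families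
    of [R_+] and of the kernel of [R -> G], which differ by a shift, comparable. *)
Definition ev (p : regular RR) : A^o := (rees_val p).[1].

Lemma evM p n c : rees_val p = c *: 'X^n -> ev p = c.
Proof. by rewrite /ev => ->; rewrite hornerZ hornerXn expr1n mulr1. Qed.

Lemma ev_morph s P P0 PB Px G Gi Gm :
  (forall n p, P n p -> ext_comp G (n + s) (ev p)) ->
  morph s (ev : @famC RR xR (regular RR) P P0 PB Px -> @extC A a G Gi Gm).
Proof.
move=> evP; split=> //=.
- by move=> u v; rewrite /ev hornerD hornerN.
- by move=> v; rewrite /ev horner0.
- by move=> j v; rewrite /ev /mulA hornerM hornerZ hornerXn expr1n mulr1.
- by move=> p v; rewrite /leaf_pr /ev; case: ifP => //; rewrite horner0.
Qed.

Lemma ev_inj n p : @gm_comp _ (regular RR) n p -> ev p = 0 -> p = 0.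
Proof.
case: n => [n [c _ pE]|n -> //]; rewrite (evM pE) => c0.
by apply: val_inj; rewrite /= pE c0 scale0r.
Qed.

Lemma van_RC D (p n : int) : van r D RC p n <-> van r D AC p n.
Proof.
rewrite -{2}[n]addr0; apply: (@van_iso _ _ 0 RC AC ev).
- apply: ev_morph => m q; rewrite addr0.
  by case: m => [m [c Fc /evM ->]|m ->] //; rewrite /ev horner0.
- move=> m c; rewrite addr0; case: m => [m|m] /= Fc.
    exists (Rees (rees_mono_subproof Fc)); [by exists c | exact: evM].
  by exists 0 => //; rewrite (Fc : c = 0) /ev horner0.
- by move=> m q; exact: ev_inj.
Qed.

Lemma van_plusC D (p n : int) : van r D plusC p n <-> van r D ACplus p n.
Proof.
rewrite -{2}[n]addr0; apply: (@van_iso _ _ 0 plusC ACplus ev).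
- apply: ev_morph => m q; rewrite addr0; case: m => [[|m]|m] [].
  + by move=> [c Fc qE]; rewrite (evM qE) qE coefZ coefXn mulr1.
  + by move=> [c Fc /evM ->].
  + by move=> ->; rewrite /ev horner0.
- move=> m c; rewrite addr0; case: m => [[|m]|m] /= Fc.
  + exists 0; first exact: plus_comp0.
    by rewrite (Fc : c = 0) /ev horner0.
  + exists (Rees (rees_mono_subproof Fc)); last exact: evM.
    by split; [exists c | rewrite coefZ coefXn mulr0].
  + exists 0; first exact: plus_comp0.
    by rewrite (Fc : c = 0) /ev horner0.
- by move=> m q [Pq _]; exact: ev_inj Pq.
Qed.

Lemma van_kerC D (p n : int) : van r D kerC p n <-> van r D ACplus p (n + 1).
Proof.
apply: (@van_iso _ _ 1 kerC ACplus ev).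
- apply: ev_morph => m q; case: m => [m|m] [].
  + move=> [c Fc qE] /assoc_pi_eq0/(_ m); rewrite (evM qE) qE coefZ coefXn eqxx mulr1.
    by rewrite addrC.
  + by move=> -> _; rewrite /ev horner0; exact: (ext_comp0 fil_plus_ideal).
- move=> m c; case: m => [m|m] Fc.
    rewrite addrC in Fc; have Fc' : F m c by exact: fil_decr.
    exists (Rees (rees_mono_subproof Fc')); last exact: evM.
    split; first by exists c.
    apply/assoc_pi_eq0 => k; rewrite /= coefZ coefXn.
    by case: eqP => [->|_]; rewrite ?mulr1 // mulr0; case: (fil_ideal F k.+1).
  exists 0; first exact: ker_comp0.
  suff -> : c = 0 by rewrite /ev horner0.
  by case: m Fc => [|m].
- by move=> m q [Pq _]; exact: ev_inj Pq.
Qed.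

Lemma ker_ses : @ses _ _ _ 0 kerC RC GC id (@assoc_pi A F).
Proof.
split.
- by split=> // n v [dv _]; rewrite addr0.
- split=> /=.
  + exact: assoc_piB.
  + by move=> v; rewrite /leaf_dif /assoc_pi rmorph0.
  + by move=> j v; rewrite /mulx; exact: assoc_piM.
  + by move=> p v; rewrite /leaf_pr; case: ifP => // _; rewrite /assoc_pi rmorph0.
  + move=> [n|n] v Pv; rewrite addr0; first by exists v.
    by rewrite (Pv : v = 0) /assoc_pi rmorph0.
- move=> [n|n] c; first by move=> [p Pp <-]; exists p.
  by move=> ->; exists 0 => //; rewrite /assoc_pi rmorph0.
- by move=> n c; rewrite addr0 => Pc c0; exists c.
- by [].
- by move=> n q [].
Qed.

(** [A = R / R_+], on which the operators vanish. *)
Definition zero_op (j : nat) (v : A^o) : A^o := 0.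

Lemma zero_op_linear j : linear (zero_op j).
Proof. by move=> c u v; rewrite /zero_op scaler0 addr0. Qed.

HB.instance Definition _ j :=
  GRing.isLinear.Build A A^o A^o *:%R (zero_op j) (zero_op_linear j).

Definition base_comp (n : int) : set A^o := if n == 0 then setT else [set 0].

Lemma base_comp0 n : base_comp n 0.
Proof. by rewrite /base_comp; case: ifP. Qed.

Lemma base_compB n u v : base_comp n u -> base_comp n v -> base_comp n (u - v).
Proof. by rewrite /base_comp; case: ifP => // _ -> ->; rewrite /= subrr. Qed.

Lemma base_compx j n v : base_comp n v -> base_comp (n + 1) (zero_op j v).
Proof. by move=> _; exact: base_comp0. Qed.

Definition baseC : opcx A :=
  @leaf A A^o zero_op base_comp (fun _ _ _ => erefl) base_comp0 base_compB base_compx.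

Definition coef_zero (p : regular RR) : A^o := (rees_val p)`_0.

Lemma plus_ses : @ses _ _ _ 0 plusC RC baseC id coef_zero.
Proof.
split.
- by split=> // n v [dv _]; rewrite addr0.
- split=> /=.
  + by move=> u v; rewrite /coef_zero coefB.
  + by move=> v; rewrite /coef_zero coef0.
  + by move=> j v; rewrite /coef_zero coef0M coefZ coefXn mulr0 mul0r.
  + by move=> p v; rewrite /leaf_pr /coef_zero; case: ifP => // _; rewrite coef0.
  + move=> [[|n]|n] v Pv; rewrite addr0 //.
      by case: Pv => c _ vE; rewrite /coef_zero /base_comp /= vE coefZ coefXn mulr0.
    by rewrite (Pv : v = 0) /coef_zero /base_comp /= coef0.
- move=> n c; rewrite /= /base_comp; case: eqP => [->|_] Pc.
    have Fc : F 0%N c by rewrite fil_0.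
    exists (Rees (rees_mono_subproof Fc)); first by exists c.
    by rewrite /coef_zero coefZ coefXn mulr1.
  exists 0; first exact: (@mod_comp0 _ (regular RR)).
  by rewrite (Pc : c = 0) /coef_zero coef0.
- by move=> n c; rewrite addr0 => Pc c0; exists c.
- by [].
- by move=> n q [].
Qed.

Lemma van_baseC (p n : int) : p != 0 \/ n != 0 -> van r setT baseC p n.
Proof.
have [->|p0 _] := eqVneq p 0; last by apply: (@van_nil _ baseC _ r 1).
case=> // n0'; move=> k _ c /coc0P -[//|v [-> dv xv]].
exists k, 0; split=> //; first exact: bideg_0.
move: dv; rewrite /= /base_comp (negbTE n0') => ->.
by rewrite cochain0_0 tau_id linear0.
Qed.

(** * The long exact sequences of [R], [G] and [R_+] *)

Section Sequences.
Local Notation vR := (van r setT RC).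
Local Notation vG := (van r setT GC).
Local Notation vP := (van r setT ACplus).

Lemma vR_of_vG (p n : int) : vP p (n + 1) -> vG p n -> vR p n.
Proof.
by move=> /van_kerC vk; rewrite -[n]addr0 => vg; exact: (van_mid ker_ses).
Qed.

Lemma vG_of_vR (p n : int) : vP (p + 1) (n + 1) -> vR p n -> vG p n.
Proof.
by move=> /van_kerC vk; rewrite -[n]addr0 => vr; exact: (van_quot ker_ses).
Qed.

Lemma vP_of_vR (p n : int) : vG p n -> vR (p + 1) n -> vP (p + 1) (n + 1).
Proof.
move=> vg vr; apply/van_kerC; rewrite -[n]addr0 in vg vr.
exact: (van_sub ker_ses).
Qed.

Lemma vR_vP (p n : int) : (p != 1) || (n != 0) -> vR p n -> vP p n.
Proof.
move=> pn vr; apply/van_plusC; rewrite -[p](subrK 1); apply: (van_sub plus_ses).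
  rewrite addr0; apply: van_baseC; case/orP: pn => [p1|]; [left; lia | by right].
by rewrite subrK addr0.
Qed.

Lemma GC_low (n : int) : n < 0 -> forall v, deg GC n v -> v = 0.
Proof. by case: n. Qed.

Lemma van0_low (B : nzRingType) (C : opcx B) n : concentrated C ->
  (forall n, n < 0 -> forall v, deg C n v -> v = 0) -> n < 0 -> van r setT C 0 n.
Proof.
move=> Cc Clow n0' k _ c /(coc0P Cc)[v [-> dv _]].
exists k, 0; split=> //; first exact: bideg_0.
by rewrite (Clow n n0' v dv) cochain0_0 tau_id linear0.
Qed.

Lemma vG_low (n : int) : n < 0 -> vG 0 n.
Proof. by move=> ?; apply: van0_low => //; exact: GC_low. Qed.

(** Since [G] has no elements of negative degree, a class of [H^1(G)] of negative
    degree is a cocycle modulo nothing, and it vanishes as soon as its products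
    with the operators do. *)
Lemma vG1_pred (n : int) : n + 1 < 0 -> vG 1 (n + 1) -> vG 1 n.
Proof.
move=> n1 vg k _ c cc; have [[dc pc] zc] := cc.
have Cc : concentrated GC by [].
have cj j : exists k', (k <= k')%N /\ tau r k k' GC (op _ j c) = 0.
  have [|k' [b [_ kk' hb e]]] := vg k I (op _ j c).
    by split; [exact: bideg_op | rewrite dif_op zc linear0].
  exists k'; split=> //; rewrite e (_ : b = 0) ?linear0 //.
  by apply: (koszul_low Cc GC_low hb); rewrite subrr mul0r addr0.
have all_j s : exists2 k', (k <= k')%N &
    forall j, (j < s)%N -> tau r k k' GC (op _ j c) = 0.
  elim: s => [|s [k1 kk1 k1P]]; first by exists k.
  have [k2 [kk2 k2P]] := cj s.
  exists (maxn k1 k2); first exact: leq_trans (leq_maxl _ _).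
  move=> j; rewrite ltnS leq_eqVlt => /predU1P[->|js].
    rewrite -(tau_tau _ kk2 (leq_maxr k1 k2)) k2P.
    exact: (morph0 (tau_morph _ _ (leq_maxr k1 k2))).
  rewrite -(tau_tau _ kk1 (leq_maxl k1 k2)) k1P //.
  exact: (morph0 (tau_morph _ _ (leq_maxl k1 k2))).
have [k' kk' k'P] := all_j r.
exists k'.+1, 0; split=> //; [exact: leqW | exact: bideg_0 |].
by rewrite linear0; apply: (tau_op_eq0 Cc kk' (p := 1)).
Qed.

(** The class of [1] in [H^1(R_+)] is the obstruction to lifting [1] from
    [A = R / R_+] to a torsion element of [R], which could only be [1]. *)
Lemma vP1_nil : vP 1 0 -> exists k, forall j, (j < r)%N -> a j ^+ k = 0.
Proof.
move=> /van_plusC vp.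
have Cc : concentrated baseC by []. have Rc : concentrated RC by [].
have [|k [c [b [_ k1 /(coc0P Rc)[y [-> [c' _ yE] xy]] [_ pb]]]]] :=
    van_hsurj plus_ses (p := 0) (n := 0) vp I (c' := @cochain0 _ r 1 baseC (1 : A)).
  by apply/(coc0P Cc); exists 1.
rewrite (koszul_pr_neg Cc _ pb) // linear0 addr0 tau_cochain0 //.
rewrite (kmap_cochain0 _ _ _ (ses_h plus_ses)) => /cochain0_inj; rewrite /coef_zero => y1.
exists k => j jr; have := xy j jr; rewrite opx_fam => /(congr1 ev).
rewrite /ev hornerM horner0 rmorphXn horner_exp hornerZ hornerXn expr1n mulr1.
have -> : (rees_val (y : rees F)).[1] = 1.
  by move: y1; rewrite yE coefZ coefXn hornerZ hornerXn expr1n.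
by rewrite mulr1.
Qed.

End Sequences.

(** * Powers of the irrelevant ideals *)

Definition order_ge (m : nat) (p : rees F) : Prop :=
  forall i, (i < m)%N -> (rees_val p)`_i = 0.

Lemma order_ge_ideal m : is_ideal (order_ge m : set RR).
Proof.
split; first by move=> i _; exact: coef0.
move=> c u v uP vP i im; rewrite coefD vP // addr0 coefM big1 // => l _.
by rewrite uP ?mulr0 //; apply: leq_ltn_trans im; exact: leq_subr.
Qed.

Lemma order_geM m m' p q : order_ge m p -> order_ge m' q -> order_ge (m + m') (p * q).
Proof.
move=> pP qP i im; rewrite coefM big1 // => l _.
have [lm|ml] := ltnP l m; first by rewrite pP ?mul0r.
by rewrite qP ?mulr0 //; move: (ltn_ord l) => /=; lia.
Qed.

Lemma order_ge_comp n p : rees_comp n p -> order_ge n p.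
Proof.
by move=> [c _ pE] i im; rewrite pE coefZ coefXn; case: eqP => [e|_]; rewrite ?mulr0 //; move: im; rewrite e ltnn.
Qed.

Lemma ideal_span_sub (B : comNzRingType) (I X : set B) : is_ideal I ->
  X `<=` I -> ideal_span X `<=` I.
Proof.
move=> Ii XI _ [m [c [g [gX ->]]]]; apply: (ideal_sum Ii) => i.
exact: (idealM _ Ii (XI _ (gX i))).
Qed.

Lemma irrelevant_order : @irrelevant_ideal RR `<=` order_ge 1.
Proof.
apply: ideal_span_sub; first exact: order_ge_ideal.
by move=> p [n n1 /order_ge_comp pP] i i1; apply: pP; exact: leq_trans n1.
Qed.

Lemma ideal_pow_order m : ideal_pow (@irrelevant_ideal RR) m `<=` order_ge m.
Proof.
elim: m => [|m IH]; first by move=> p _ i.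
apply: ideal_span_sub; first exact: order_ge_ideal.
by move=> _ [u [v [/irrelevant_order uP /IH vP ->]]]; exact: (order_geM uP vP).
Qed.

(** Apply [I_n = I * I_(n-1)], valid for [n] larger than [n0], to each
    coefficient. *)
Lemma order_span p : order_ge n0.+1 p ->
  exists t : nat -> RR, p = \sum_(j < r) xR j * t j.
Proof.
move=> pP; pose W := [set p : RR | exists t : nat -> RR, p = \sum_(j < r) xR j * t j].
have Wi : is_ideal W.
  split; first by exists (fun=> 0); rewrite big1 // => j _; rewrite mulr0.
  move=> c _ _ [t ->] [t' ->]; exists (fun j => c * t j + t' j).
  by rewrite mulr_sumr -big_split; apply: eq_bigr => j _ /=; ring.
suff : W (\sum_(n <- iota 0 (size (rees_val p))) rees_mono p n) by rewrite -rees_mono_sum.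
rewrite big_seq; elim/big_ind: _ => [|u v|n _]; first by case: Wi.
  exact: (idealD Wi).
have [nn|] := ltnP n n0.+1.
  have -> : rees_mono p n = 0 :> RR by apply: val_inj; rewrite /= pP // scale0r.
  by case: Wi.
case: n => // n n0n; have [y Fy pnE] := Fgen n0n (reesP p n.+1).
exists (fun j => Rees (rees_mono_subproof (Fy j))); apply: val_inj => /=.
rewrite [RHS](rees_val_sum _ (fun j : 'I_r => xR j * Rees (rees_mono_subproof (Fy j)))) pnE.
rewrite scaler_suml; apply: eq_bigr => j _ /=.
by rewrite -scalerAl -scalerAr scalerA exprS expr1.
Qed.

Lemma xR_pow : exists m, forall s, ideal_pow (@irrelevant_ideal RR) m s ->
  exists t : nat -> RR, s = \sum_(j < r) xR j * t j.
Proof. by exists n0.+1 => s /ideal_pow_order/order_span. Qed.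

Lemma assoc_pi_surj (g : GG) : exists p, assoc_pi p = g.
Proof. by exists (repr g); exact: reprK. Qed.

Lemma im_order_ideal m : is_ideal ([set assoc_pi p | p in order_ge m] : set GG).
Proof.
split; first by exists 0; [case: (order_ge_ideal m) | rewrite /assoc_pi rmorph0].
move=> c _ _ [u uP <-] [v vP <-]; have [d <-] := assoc_pi_surj c.
exists (d * u + v); first exact: (order_ge_ideal m).2.
by rewrite /assoc_pi rmorphD rmorphM.
Qed.

Lemma ideal_pow_assoc m :
  ideal_pow (@irrelevant_ideal GG) m `<=` [set assoc_pi p | p in order_ge m].
Proof.
elim: m => [|m IH].
  by move=> g _; have [p <-] := assoc_pi_surj g; exists p.
apply: ideal_span_sub; first exact: im_order_ideal.
move=> _ [u [v [uI /IH[q qP <-] ->]]].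
have [p pP <-] : [set assoc_pi p | p in order_ge 1] u.
  move: uI; apply: ideal_span_sub; first exact: im_order_ideal.
  move=> _ [n n1 [p /order_ge_comp pP <-]]; exists p => // i i1.
  by apply: pP; exact: leq_trans n1.
by exists (p * q); [exact: (order_geM pP qP) | exact: assoc_piM].
Qed.

Lemma xG_pow : exists m, forall s, ideal_pow (@irrelevant_ideal GG) m s ->
  exists t : nat -> GG, s = \sum_(j < r) xG j * t j.
Proof.
exists n0.+1 => _ /ideal_pow_assoc[p /order_span[t ->] <-].
exists (fun j => assoc_pi (t j)); rewrite assoc_pi_sum.
by apply: eq_bigr => j _; rewrite -assoc_piM.
Qed.

(** * Acyclicity of the Koszul complexes of [R] and [G] *)

Hypothesis noethA : noetherian A.

Lemma RC_acyclic : exists c0 : int, forall k p (n : int), c0 < n -> van r [set k] RC p n.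
Proof.
have [c0 c0P] := extC_acyclic (fil_ideal F) a_mul noethA Fgen.
by exists c0 => k p n nc; apply/van_RC; exact: c0P.
Qed.

Lemma GC_acyclic : exists c0 : int, forall k p (n : int), c0 < n -> van r [set k] GC p n.
Proof.
have [c0 c0P] := RC_acyclic; exists (Num.max c0 0) => k p n.
rewrite gt_max => /andP[cn n1]; rewrite -[n]addr0; apply: (van_quot ker_ses).
  apply/van_kerC/van_plusC; apply: (van_sub plus_ses); rewrite addr0.
    apply: van_deg_eq0 => m nm v; rewrite /= /base_comp.
    by case: eqP => // m0; move: nm; rewrite m0; lia.
  by apply: c0P; lia.
by rewrite addr0; exact: c0P.
Qed.

(** * Nilpotence of [I_1] *)

Lemma nilradicalD (x y : A) : nilradical A x -> nilradical A y -> nilradical A (x + y).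
Proof.
move=> [m xm] [n yn]; exists (m + n)%N; rewrite exprDn big1 // => i _.
have [im|mi] := leqP i n.
  have -> : (m + n - i)%N = (m + (n - i))%N by lia.
  by rewrite exprD xm !mul0r mul0rn.
have -> : nat_of_ord i = (n + (i - n))%N by lia.
by rewrite exprD yn mul0r mulr0 mul0rn.
Qed.

(** The [n0 + 1]-st power of an element of [I_1] lies in [I_(n0 + 1)], which is
    contained in the ideal of the [a j]. *)
Lemma nilpotent_generators : F 1%N `<=` nilradical A <->
  exists k, forall j, (j < r)%N -> a j ^+ k = 0.
Proof.
split=> [nil|[k ak] x Fx].
  elim: r => [|s [k kP]]; first by exists 0%N.
  have [m am] := nil _ (a1 s); exists (k + m)%N => j.
  rewrite ltnS leq_eqVlt exprD => /predU1P[->|/kP ->]; last by rewrite mul0r.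
  by rewrite am mulr0.
have Fxn n : F n (x ^+ n).
  elim: n => [|n IH]; first by rewrite fil_0.
  by rewrite exprS; exact: (fil_prod Fx IH).
have [y _ xE] := Fgen (leqnn n0) (Fxn n0.+1).
have [m xm] : nilradical A (x ^+ n0.+1).
  rewrite xE; elim/big_ind: _ => [|u v|j _]; first by exists 1%N; rewrite expr1.
    exact: nilradicalD.
  by exists k; rewrite exprMn ak // mul0r.
by exists (n0.+1 * m)%N; rewrite exprM.
Qed.

Lemma xR_nil j k : a j ^+ k = 0 -> xR j ^+ k = 0.
Proof. by move=> ak; apply: val_inj; rewrite rmorphXn /= exprZn ak scale0r. Qed.

Lemma vR_nil (p n : int) : F 1%N `<=` nilradical A -> p != 0 -> van r setT RC p n.
Proof.
move=> /nilpotent_generators[k ak] p0; apply: (@van_nil _ RC _ r k) => // j jr v.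
by rewrite opx_fam xR_nil ?ak // scale0r.
Qed.

End Rees.

(** * Comparison of the top degrees *)

Section MaxDegree.
Implicit Types P Q : set int.

Lemma max_degreeE P m : is_max P m -> max_degree P = m%:E.
Proof.
move=> [Pm mP]; rewrite /max_degree; case: (pselect (exists m, is_max P m)) => [h|[]]; last by exists m.
case: (projT2 (cid h)) => Pk kP; congr (_%:E); apply/eqP.
by rewrite eq_le mP // kP.
Qed.

Lemma bounded_has_max P b n : (forall m, P m -> m <= b) -> P n -> exists m, is_max P m.
Proof.
move=> Pb Pn; pose Q k := `[< P (n + k%:Z) >].
have Q0 : exists k, Q k by exists 0%N; apply/asboolP; rewrite addr0.
have Qb k : Q k -> (k <= `|b - n|)%N by move=> /asboolP/Pb; lia.
case: (ex_maxnP Q0 Qb) => k /asboolP Qk kP; exists (n + k%:Z); split=> // m Pm.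
have [mn|/ltW nm] := leP m n; first by lia.
have /kP : Q `|m - n|%N.
  by apply/asboolP; rewrite (_ : n + _ = m) //; lia.
by lia.
Qed.

Lemma max_degree_le P Q b : (forall m, Q m -> m <= b) ->
  (forall n, P n -> exists2 m, Q m & n <= m) -> (max_degree P <= max_degree Q)%E.
Proof.
move=> Qb PQ; have [[n Pn]|] := pselect (exists n, P n).
  have [m0 Qm0 _] := PQ n Pn; have [m mQ] := bounded_has_max Qb Qm0.
  have Pm n' : P n' -> n' <= m.
    by move=> /PQ[k Qk nk]; apply: le_trans nk _; exact: mQ.2.
  have [n' nP] := bounded_has_max Pm Pn.
  by rewrite (max_degreeE mQ) (max_degreeE nP) lee_fin; exact: Pm nP.1.
move=> nP; suff -> : max_degree P = -oo%E by exact: leNye.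
rewrite /max_degree; case: (pselect (exists m, is_max P m)) => [h|_].
  by case: nP; case: h => m [Pm _]; exists m.
by case: asboolP => // -[]; apply/seteqP; split=> // m Pm; case: nP; exists m.
Qed.

Lemma max_degree_ub P m n : (max_degree P <= m%:E)%E -> P n -> n <= m.
Proof.
rewrite /max_degree; case: (pselect (exists m, is_max P m)) => [h|_].
  rewrite lee_fin => km Pn; apply: le_trans km.
  by case: (projT2 (cid h)) => _; exact.
by case: asboolP => // ->.
Qed.

End MaxDegree.

Theorem theorem3p2 (A : comNzRingType) (F : filtration A)
  (noethA : noetherian A) (goodF : good_filtration F)
  (ER : injective_resolution (regular (rees_algebra F)))
  (EG : injective_resolution (regular (assoc_graded_ring F))) :
  [/\ forall i : nat, i <> 1%N -> (a_inv ER i <= a_inv EG i)%E,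
      forall i : nat, i <> 1%N ->
        (a_inv EG i.+1 <= a_inv EG i)%E -> a_inv ER i = a_inv EG i,
      lc_neq0 EG 1 \/ F 1%N `<=` nilradical A ->
        (a_inv ER 1 <= a_inv EG 1)%E /\
        ((a_inv EG 2 <= a_inv EG 1)%E -> a_inv ER 1 = a_inv EG 1) &
      ~ lc_neq0 EG 1 /\ ~ (F 1%N `<=` nilradical A) ->
        a_inv ER 1 = ((-1)%:E)%E].
Proof.
have [r [n0 [a [a1 Fgen]]]] := good_generators noethA goodF.
have [cR acR] := RC_acyclic a1 Fgen noethA.
have [cG acG] := GC_acyclic a1 Fgen noethA.
have xRP := xR_pow a1 Fgen; have xGP := xG_pow a1 Fgen.
pose vR (i : nat) n := van r setT (modC (xR1 a1) (regular (rees_algebra F))) i%:Z n.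
pose vG (i : nat) n := van r setT (modC (xG1 a1) (regular (assoc_graded_ring F))) i%:Z n.
have RP i n : lc_comp_neq0 ER i n <-> ~ vR i n by exact: lc_comp_van acR i n.
have GP i n : lc_comp_neq0 EG i n <-> ~ vG i n by exact: lc_comp_van acG i n.
have R_bound i n : lc_comp_neq0 ER i n -> n <= cR.
  move=> /RP nv; rewrite leNgt; apply/negP => cn; apply: nv.
  by apply: van1_van => k; exact: acR.
have G_bound i n : lc_comp_neq0 EG i n -> n <= cG.
  move=> /GP nv; rewrite leNgt; apply/negP => cn; apply: nv.
  by apply: van1_van => k; exact: acG.
(* In a degree where H^i(G) vanishes, H^i(R_+)_(n + 1) -> H^i(R)_n is surjective,
   and H^i(R_+) embeds in H^i(R) except for i = 1 in degree 0. *)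
have climb (i : nat) (n : int) : (i%:Z != 1) || (0 <= n) -> lc_comp_neq0 ER i n ->
    exists2 m, lc_comp_neq0 EG i m & n <= m.
  have [N] := ubnP `|(cR + 1 - n)%R|%N; elim: N n => // N IH n nN i_n hR.
  have nc := R_bound _ _ hR.
  have [vg|nvg] := pselect (vG i n); last by exists n => //; apply/GP.
  have [|||m hm nm] := IH (n + 1).
  - by lia.
  - by move: i_n; lia.
  - apply/RP => vr; move/RP: hR; apply; apply: vR_of_vG vg.
    by apply: vR_vP vr; move: i_n; lia.
  by exists m => //; lia.
(* At the top degree m of H^i(G), the obstruction to lifting a nonzero class to
   H^i(R) lies in H^(i + 1)(R)_(m + 1), which vanishes by climbing again. *)
have eq_inv (i : nat) : (forall n : int, lc_comp_neq0 ER i n ->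
      exists2 m, lc_comp_neq0 EG i m & n <= m) ->
    (a_inv EG i.+1 <= a_inv EG i)%E -> a_inv ER i = a_inv EG i.
  move=> RG le_a; apply/eqP; rewrite eq_le; apply/andP; split.
    exact: max_degree_le (G_bound i) RG.
  apply: max_degree_le (R_bound i) _ => n hn.
  have [m mG] := bounded_has_max (G_bound i) hn.
  exists m; last exact: mG.2.
  move: le_a; rewrite /a_inv (max_degreeE mG) => /max_degree_ub ub.
  have m0 : i = 0%N -> 0 <= m.
    move=> i0; rewrite leNgt; apply/negP => m0; case: mG => /GP + _; apply.
    by rewrite i0; exact: vG_low.
  apply/RP => vr; case: mG => /GP nvg _; apply: nvg.
  apply: vG_of_vR vr; apply: vR_vP.
    by case: (i) m0 => [/(_ erefl)|]; lia.
  apply: contrapT => nvr.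
  have e : i%:Z + 1 = i.+1%:Z by lia.
  rewrite e in nvr; have [||k /ub km mk] := climb i.+1 (m + 1).
  - by case: (i) m0 => [/(_ erefl)|]; lia.
  - exact/RP.
  by move: (le_trans mk km); lia.
have le_inv (i : nat) : i <> 1%N -> forall n : int, lc_comp_neq0 ER i n ->
    exists2 m, lc_comp_neq0 EG i m & n <= m.
  by move=> i1 n; apply: climb; lia.
split.
- by move=> i /le_inv; exact: max_degree_le (G_bound i).
- by move=> i /le_inv; exact: eq_inv.
- move=> G1; have RG n : lc_comp_neq0 ER 1 n -> exists2 m, lc_comp_neq0 EG 1 m & n <= m.
    move=> hR; case: G1 => [/(lc_neq0_comp (xG1 a1) xGP)[l hl]|nil]; last first.
      by move/RP: hR; case; apply: (vR_nil (a := a) Fgen).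
    have [n0'|nn] := leP 0 n; first exact: climb.
    (* Climbing fails to cross from degree -1 to degree 0, but then H^1(G) is
       nonzero in some degree at least -1. *)
    have [m hm m1] : exists2 m, lc_comp_neq0 EG 1 m & -1 <= m.
      have [l1|] := leP (-1) l; first by exists l.
      have [N] := ubnP `|l|%N; elim: N l hl => // N IH l hl lN l1.
      have hl1 : lc_comp_neq0 EG 1 (l + 1).
        by apply/GP => vg; move/GP: hl; apply; apply: vG1_pred vg; lia.
      have [|] := leP (-1) (l + 1); first by exists (l + 1).
      by apply: IH => //; lia.
    by exists m => //; lia.
  split; first exact: max_degree_le (G_bound 1%N) RG.
  exact: eq_inv.
- move=> [nG nnil]; apply: max_degreeE; split.
    (* H^1(R)_(-1) contains H^1(R_+)_0, because H^0(G)_(-1) = 0. *)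
    apply/RP => vr; apply: nnil; apply/(nilpotent_generators a1 Fgen).
    by apply: (@vP1_nil _ _ _ _ a1); apply: (vP_of_vR (p := 0) (n := -1)) vr; exact: vG_low.
  move=> n hR; rewrite leNgt; apply/negP => n1.
  have [|m hm _] := climb 1%N n _ hR; first by lia.
  by apply: nG; apply/(lc_neq0_comp (xG1 a1) xGP); exists m.
Qed.
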